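(* Let $0<p<1$, let $\{X_n,\ n\ge1\}$ be the steps of the elephant random walk that remembers only the first step, with $P(X_1=1)=p=1-P(X_1=-1)$, and let $S_n=\sum_{k=1}^n X_k$. Then: (a) $\dfrac{S_n-n(2p-1)X_1}{\sqrt{4np(1-p)}}$ converges in distribution to the standard normal law as $n\to\infty$; (b) $\dfrac{S_n-n(2p-1)X_1}{n}\to 0$ almost surely as $n\to\infty$; (c) almost surely, $$\limsup_{n\to\infty}\frac{S_n-n(2p-1)X_1}{\sqrt{8np(1-p)\log\log n}}=1\quad\text{and}\quad \liminf_{n\to\infty}\frac{S_n-n(2p-1)X_1}{\sqrt{8np(1-p)\log\log n}}=-1.$$
   Context: Elephant random walk remembering only the first step: for every $n\ge1$, $X_{n+1}=X_1$ with probability $p$ and $X_{n+1}=-X_1$ with probability $1-p$, i.e. $X_{n+1}=\varepsilon_{n+1}X_1$ where $\varepsilon_2,\varepsilon_3,\dots$ are i.i.d. with $P(\varepsilon_i=1)=p=1-P(\varepsilon_i=-1)$ and independent of $X_1$. *)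

(* Defs.v *)
From HB Require Import structures.
From mathcomp Require Import all_boot all_order all_algebra finmap.
From mathcomp Require Import all_classical all_reals all_analysis.

Set Implicit Arguments.
Unset Strict Implicit.
Unset Printing Implicit Defensive.

Import Order.TTheory GRing.Theory Num.Theory.
Import numFieldNormedType.Exports.

Local Open Scope classical_set_scope.
Local Open Scope ring_scope.

Definition mutually_independent d (T : measurableType d) (R : realType)
    (P : probability T R) (I : choiceType) (D : set I)
    (X : I -> {RV P >-> R}) : Prop :=
  forall J : {fset I}, [set` J] `<=` D ->
  forall B : I -> set R, (forall i, measurable (B i)) ->
    P (\bigcap_(i in [set` J]) (X i @^-1` B i)) =
    (\prod_(i <- J) P (X i @^-1` B i))%E.

(* Independence of the sigma-algebra of [Y] and the sigma-algebra generated
   by the whole family [X i], [i] in [D]. *)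
Definition independent_of_family d (T : measurableType d) (R : realType)
    (P : probability T R) (Y : {RV P >-> R}) (I : Type) (D : set I)
    (X : I -> {RV P >-> R}) : Prop :=
  forall A B : set T,
    preimage_set_system setT Y measurable A ->
    <<s \bigcup_(i in D) preimage_set_system setT (X i) measurable >> B ->
    P (A `&` B) = (P A * P B)%E.

(* [Y] is a sequence of plain functions, so that it can be given by a pointwise
   formula; the first conjunct says that they are random variables. *)
Definition cvg_in_distribution d (T : measurableType d) (R : realType)
    (P : probability T R) (Y : nat -> T -> R)
    (mu : probability (measurableTypeR R) R) : Prop :=
  (forall n, measurable_fun setT (Y n)) /\
  forall x : R, {for x, continuous (fun y : R => mu `]-oo, y]%classic)} ->
    P (Y n @^-1` `]-oo, x]%classic) @[n --> \oo] --> mu `]-oo, x]%classic.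

Definition sign_law d (T : measurableType d) (R : realType)
    (P : probability T R) (p : R) (Y : {RV P >-> R}) : Prop :=
  P (Y @^-1` [set 1]) = p%:E /\ P (Y @^-1` [set -1]) = (1 - p)%:E.

(* [X] is indexed from 1 and [eps] from 2; the values at smaller indices are
   irrelevant. *)
Definition first_step_elephant_walk d (T : measurableType d) (R : realType)
    (P : probability T R) (p : R) (X : nat -> {RV P >-> R}) : Prop :=
  sign_law p (X 1%N) /\
  exists eps : nat -> {RV P >-> R},
    [/\ forall n, (2 <= n)%N -> sign_law p (eps n),
        mutually_independent [set n | (2 <= n)%N] eps,
        independent_of_family (X 1%N) [set n | (2 <= n)%N] eps &
        forall n, (1 <= n)%N -> forall w, X n.+1 w = eps n.+1 w * X 1%N w].

Definition position (T : Type) (R : realType) (X : nat -> T -> R)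
    (n : nat) (w : T) : R :=
  \sum_(1 <= k < n.+1) X k w.

Definition centered_position (T : Type) (R : realType) (p : R)
    (X : nat -> T -> R) (n : nat) (w : T) : R :=
  position X n w - n%:R * (2 * p - 1) * X 1%N w.

(* Main.v *)
Require Import Defs.
From HB Require Import structures.
From mathcomp Require Import all_boot all_order all_algebra finmap.
From mathcomp Require Import all_classical all_reals all_analysis.
From mathcomp Require Import measurable_realfun ring lra.

(* The signs b_0 = [X_1 = 1] and b_i = [eps_{i+1} = 1] are i.i.d. with parameter
   p, and the centered position is X_1 times the centered walk T_n of these
   bits, up to an additive constant.  Everything thus reduces to T_n, a sum of
   i.i.d. steps 2(1-p) or -2p of variance 4p(1-p).
   The central limit theorem for T_n is Lindeberg's argument along the heat
   flow: u(t,y) = Phi(y / sqrt t) solves the heat equation, so that replacing a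
   step of the walk by the same amount of Gaussian time costs O(t^(-3/2)).  A
   small initial time delta * n smooths the indicator function.
   The upper half of the law of the iterated logarithm is the exponential
   maximal inequality on the blocks [(1+e)^k, (1+e)^(k+1)].  For the lower half,
   block k consists of about ln k / kap sub-blocks of length B^k; by the central
   limit theorem each of them exceeds K standard deviations with probability at
   least exp(-kap), where 2 kap ~ K^2 for large K.  They all do so with
   probability at least 1/k, hence infinitely often; this yields the sharp
   constant since K * sqrt(ln k / kap) ~ sqrt(2 ln k). *)

Import Order.TTheory GRing.Theory Num.Theory.
Import numFieldNormedType.Exports.

Set Implicit Arguments.
Unset Strict Implicit.
Unset Printing Implicit Defensive.

Local Open Scope classical_set_scope.
Local Open Scope ring_scope.

(** * Taylor bounds and the normal distribution function *)

Section taylor.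
Context {R : realType}.
Implicit Types (f df : R -> R) (x w B M : R).

Lemma is_derive_continuous f df :
  (forall y : R, is_derive y 1 f (df y)) -> continuous f.
Proof.
by move=> fdf y; apply/differentiable_continuous/derivable1_diffP; case: (fdf y).
Qed.

Lemma increment_le f df x w B : (forall y : R, is_derive y 1 f (df y)) ->
  (forall y : R, `|y - x| <= `|w| -> `|df y| <= B) -> `|f (x + w) - f x| <= B * `|w|.
Proof.
move=> fdf dfB; have cf := is_derive_continuous fdf.
have [w0|w0] := leP 0 w.
- have xw : x <= x + w by lra.
  have [c] := @MVT_segment R f df _ _ xw (fun y _ => fdf y) (continuous_subspaceT cf).
  rewrite in_itv/= => cxw ->; rewrite [x + w]addrC addrK normrM.
  by rewrite ler_wpM2r// dfB// !ger0_norm//; lra.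
- have xw : x + w <= x by lra.
  have [c] := @MVT_segment R f df _ _ xw (fun y _ => fdf y) (continuous_subspaceT cf).
  rewrite in_itv/= => cxw E; rewrite -normrN opprB E opprD addrA subrr sub0r.
  by rewrite normrM normrN ler_wpM2r// dfB// (ltr0_norm w0) ler_norml; lra.
Qed.

(** The mean value bound is applied to f minus its tangent at x, whose derivative is at most M |w|.
    The usual factor 1/2 is given up, since only the order of the error matters. *)
Lemma taylor1_le f f1 f2 x w M :
  (forall y : R, is_derive y 1 f (f1 y)) -> (forall y : R, is_derive y 1 f1 (f2 y)) ->
  (forall y : R, `|y - x| <= `|w| -> `|f2 y| <= M) ->
  `|f (x + w) - f x - f1 x * w| <= M * `|w| ^+ 2.
Proof.
move=> d1 d2 fM.
pose g y := f y - f1 x * (y - x).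
have -> : f (x + w) - f x - f1 x * w = g (x + w) - g x by rewrite /g; ring.
have M0 : 0 <= M by rewrite (le_trans _ (fM x _))// subrr normr0.
rewrite expr2 mulrA; apply: (@increment_le g (fun y => f1 y - f1 x)).
  move=> y; rewrite /g; apply: is_derive_eq.
  by rewrite /GRing.scale/=; ring.
move=> y yx; rewrite -[y](subrKC x) (le_trans (@increment_le _ _ _ _ M d2 _))//.
  by move=> u uy; apply: fM; apply: (le_trans uy).
by rewrite ler_wpM2l.
Qed.

Lemma taylor2_le f f1 f2 f3 x w M :
  (forall y : R, is_derive y 1 f (f1 y)) -> (forall y : R, is_derive y 1 f1 (f2 y)) ->
  (forall y : R, is_derive y 1 f2 (f3 y)) ->
  (forall y : R, `|y - x| <= `|w| -> `|f3 y| <= M) ->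
  `|f (x + w) - f x - f1 x * w - f2 x * (w ^+ 2 / 2)| <= M * `|w| ^+ 3.
Proof.
move=> d1 d2 d3 fM.
pose g y := f y - f1 x * (y - x) - f2 x * ((y - x) ^+ 2 / 2).
have -> : f (x + w) - f x - f1 x * w - f2 x * (w ^+ 2 / 2) = g (x + w) - g x.
  by rewrite /g; field.
have M0 : 0 <= M by rewrite (le_trans _ (fM x _))// subrr normr0.
rewrite exprSr mulrA.
apply: (@increment_le g (fun y => f1 y - f1 x - f2 x * (y - x))).
  move=> y; rewrite /g; apply: is_derive_eq.
  rewrite /GRing.scale/=. by lra.
move=> y yx; rewrite -[in f1 y](subrKC x y).
rewrite (le_trans (@taylor1_le f1 f2 f3 x (y - x) M d2 d3 _))//.
  by move=> u uy; apply: fM; apply: (le_trans uy).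
by rewrite ler_wpM2l// lerXn2r.
Qed.

End taylor.

(** * The standard normal density and distribution function *)

Section gaussian.
Context {R : realType}.
Implicit Types x y : R.

Definition gauss_pdf x : R := normal_pdf 0 1 x.
Definition gauss_cdf x : R := fine (normal_prob (0 : R) 1 `]-oo, x]).

Let expr4 x : x ^+ 4 = (x ^+ 2) ^+ 2.
Proof. by rewrite -exprM. Qed.

Lemma gauss_pdfE x : gauss_pdf x = normal_peak 1 * expR (- (x ^+ 2 / 2)).
Proof.
rewrite /gauss_pdf normal_pdfE ?oner_neq0//= /normal_fun subr0 expr1n mulNr.
by rewrite -[1 *+ 2]/(2%:R).
Qed.

Lemma normal_peak1_le1 : normal_peak (1 : R) <= 1.
Proof.
rewrite /normal_peak expr1n mul1r invf_le1.
  by rewrite -[leLHS](@sqrtr1 R) ler_sqrt; have := pi_ge2 R; lra.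
by rewrite sqrtr_gt0; have := pi_ge2 R; lra.
Qed.

Lemma gauss_pdf_gt0 x : 0 < gauss_pdf x.
Proof. by rewrite gauss_pdfE mulr_gt0 ?expR_gt0// normal_peak_gt0. Qed.

Lemma gauss_pdf_le1 x : gauss_pdf x <= 1.
Proof.
rewrite gauss_pdfE mulr_ile1 ?expR_ge0 ?normal_peak_ge0 ?normal_peak1_le1//.
by rewrite expR_le1 oppr_le0 divr_ge0 ?sqr_ge0.
Qed.

Lemma is_derive_gauss_cdf x : is_derive x 1 gauss_cdf (gauss_pdf x).
Proof.
have [||||dF F'E] :=
  @continuous_FTC1 R gauss_pdf -oo%O x (x + 1) _ _ _ _; first lra.
- by apply: (integrableS _ _ (@subsetT _ _)) => //; exact: integrable_normal_pdf.
- by rewrite ltNyr.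
- by apply: continuous_normal_pdf; exact: oner_neq0.
by apply: DeriveDef; [exact: dF|rewrite -derive1E; exact: F'E].
Qed.

Lemma is_derive_gauss_pdf x : is_derive x 1 gauss_pdf (- (x * gauss_pdf x)).
Proof.
have -> : gauss_pdf =
    (fun x => normal_peak (1 : R) * (expR \o (fun x => - (x ^+ 2 / 2))) x).
  by apply/funext => y; rewrite gauss_pdfE.
have d : is_derive x 1 (fun x : R => - (x ^+ 2 / 2)) (- x).
  apply: is_derive_eq; rewrite /GRing.scale/=; lra.
have dc := @is_derive1_comp R expR _ x _ _ (is_derive_expR _) d.
by apply: is_derive_eq; rewrite /GRing.scale/=; ring.
Qed.

Lemma is_derive2_gauss_pdf x :
  is_derive x 1 (fun x => - (x * gauss_pdf x)) ((x ^+ 2 - 1) * gauss_pdf x).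
Proof.
have d := is_derive_gauss_pdf x.
by apply: is_derive_eq; rewrite /GRing.scale/=; ring.
Qed.

(** The quadratic term of the exponential series gives exp(x^2/2) >= 1 + x^4/8. The next three
    bounds follow from this one. *)
Lemma gauss_pdf_X4 x : x ^+ 4 * gauss_pdf x <= 8.
Proof.
have e8 : 1 + x ^+ 4 / 8 <= expR (x ^+ 2 / 2).
  apply: le_trans (expR_ge1Dxn 1 _); last by rewrite divr_ge0 ?sqr_ge0.
  by rewrite (_ : 2`!%:R = 2 :> R)//; lra.
have h : x ^+ 4 * expR (- (x ^+ 2 / 2)) <= 8.
  by rewrite expRN ler_pdivrMr ?expR_gt0//; lra.
rewrite gauss_pdfE mulrCA (le_trans _ h)// ler_piMl//.
  by rewrite mulr_ge0 ?expR_ge0// expr4 sqr_ge0.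
exact: normal_peak1_le1.
Qed.

Lemma gauss_pdf_X1 x : `|x * gauss_pdf x| <= 9.
Proof.
rewrite normrM (gtr0_norm (gauss_pdf_gt0 x)).
have : `|x| <= 1 + x ^+ 4.
  rewrite expr4 -(real_normK (num_real x)); set a := `|x|.
  by have := sqr_ge0 (2 * a ^+ 2 - 1); have := sqr_ge0 (2 * a - 1); nra.
have := gauss_pdf_X4 x; have := gauss_pdf_le1 x; have := gauss_pdf_gt0 x; nra.
Qed.

Lemma gauss_pdf_X3 x : `|x| ^+ 3 * gauss_pdf x <= 9.
Proof.
have : `|x| ^+ 3 <= 1 + x ^+ 4.
  have -> : x ^+ 4 = `|x| ^+ 4.
    by rewrite -normrX ger0_norm// expr4 sqr_ge0.
  have := normr_ge0 x; set a := `|x|; move=> a0.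
  have [a1|a1] := leP a 1; first by have := exprn_ile1 3 a0 a1; have := exprn_ge0 4 a0; lra.
  by rewrite exprSr; have := exprn_ge0 3 a0; nra.
have := gauss_pdf_X4 x; have := gauss_pdf_le1 x; have := gauss_pdf_gt0 x; nra.
Qed.

Lemma gauss_pdf_derive2_le x : `|(x ^+ 2 - 1) * gauss_pdf x| <= 10.
Proof.
rewrite normrM (gtr0_norm (gauss_pdf_gt0 x)).
have : `|x ^+ 2 - 1| <= 2 + x ^+ 4.
  rewrite ler_norml.
  by rewrite expr4; have := sqr_ge0 x; nra.
have := gauss_pdf_X4 x; have := gauss_pdf_le1 x; have := gauss_pdf_gt0 x; nra.
Qed.

Lemma gauss_cdf_lip x y : `|gauss_cdf y - gauss_cdf x| <= `|y - x|.
Proof.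
rewrite -{1}[y](subrKC x) -[leRHS]mul1r.
apply: (increment_le is_derive_gauss_cdf) => u _.
by rewrite ger0_norm ?gauss_pdf_le1// ltW// gauss_pdf_gt0.
Qed.

Lemma gauss_cdf_ge0 x : 0 <= gauss_cdf x.
Proof. exact/fine_ge0/measure_ge0. Qed.

Lemma EFin_gauss_cdf x : (gauss_cdf x)%:E = normal_prob (0 : R) 1 `]-oo, x].
Proof. by rewrite fineK// fin_num_measure. Qed.

Lemma gauss_cdf_le1 x : gauss_cdf x <= 1.
Proof. by rewrite -lee_fin EFin_gauss_cdf probability_le1. Qed.

(** Under the normal law the identity is a random variable with distribution function [gauss_cdf],
    so the general limits of distribution functions at infinity apply. *)
Let idTR : measurableTypeR R -> R := idfun.

#[local] HB.instance Definition _ :=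
  @isMeasurableFun.Build _ _ _ _ idTR (@measurable_id _ _ setT).

Lemma gauss_cdf_cvg1 e : 0 < e ->
  exists M : R, forall x, M <= x -> 1 - e <= gauss_cdf x.
Proof.
move=> e0; pose X : {RV (normal_prob (0 : R) 1) >-> R} := idTR.
have := @fine_cvg _ _ _ _ _ _ (cvg_cdfy1 X).
move=> /(_ _)/cvgrPdist_le/(_ e e0) [M [_ HM]]; exists (M + 1) => x Mx.
have /HM : M < x by lra.
by rewrite /= /gauss_cdf /cdf /distribution /pushforward preimage_id ler_norml; lra.
Qed.

Lemma gauss_cdf_cvg0 e : 0 < e ->
  exists M : R, forall x, x <= M -> gauss_cdf x <= e.
Proof.
move=> e0; pose X : {RV (normal_prob (0 : R) 1) >-> R} := idTR.
have := @fine_cvg _ _ _ _ _ _ (cvg_cdfNy0 X).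
move=> /(_ _)/cvgrPdist_le/(_ e e0) [M [_ HM]]; exists (M - 1) => x Mx.
have /HM : x < M by lra.
by rewrite /= /gauss_cdf /cdf /distribution /pushforward preimage_id ler_norml; lra.
Qed.

Lemma gauss_pdfN x : gauss_pdf (- x) = gauss_pdf x.
Proof. by rewrite !gauss_pdfE sqrrN. Qed.

(** Phi(x) + Phi(-x) has derivative 0 because the density is even; its constant value is found at
    large arguments. *)
Lemma gauss_cdfN x : gauss_cdf (- x) = 1 - gauss_cdf x.
Proof.
pose f := gauss_cdf + (gauss_cdf \o -%R).
have df y : is_derive y 1 f 0.
  have d1 := is_derive_gauss_cdf y.
  have d2 := @is_derive1_comp R _ -%R y _ _ (is_derive_gauss_cdf (- y)) _.
  have {}d2 := d2 _ (is_deriveNid _ _).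
  by apply: is_derive_eq; rewrite gauss_pdfN; ring.
have fc y : f x = f y.
  apply/eqP; rewrite -subr_eq0 -normr_le0 -(mul0r `|x - y|) -{1}(subrKC y x).
  by apply: (increment_le df) => u _; rewrite normr0.
suff : `|f x - 1| <= 0 by rewrite normr_le0 subr_eq0 => /eqP; rewrite /f !fctE/=; lra.
apply/ler_addgt0Pr => e e0; rewrite add0r.
have [M1 H1] := gauss_cdf_cvg1 (divr_gt0 e0 (ltr0n _ 2)).
have [M0 H0] := gauss_cdf_cvg0 (divr_gt0 e0 (ltr0n _ 2)).
pose z := Num.max M1 (- M0).
have /H1 z1 : M1 <= z by rewrite le_max lexx.
have /H0 z0 : - z <= M0 by rewrite lerNl le_max lexx orbT.
rewrite (fc z) /f !fctE/= ler_norml.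
have := gauss_cdf_ge0 (- z); have := gauss_cdf_le1 z; lra.
Qed.

(** Phi(x + 1) - Phi(x) is a value of the density on [x, x + 1], where the density decreases. *)
Lemma gauss_cdf_tail x : 0 <= x -> gauss_pdf (x + 1) <= 1 - gauss_cdf x.
Proof.
move=> x0; have xx1 : x <= x + 1 by lra.
have [c] := @MVT_segment R _ _ _ _ xx1 (fun y _ => is_derive_gauss_cdf y)
  (continuous_subspaceT (is_derive_continuous is_derive_gauss_cdf)).
rewrite in_itv/= => /andP[xc cx1] E.
have h : gauss_pdf (x + 1) <= gauss_pdf c.
  rewrite !gauss_pdfE ler_pM2l ?normal_peak_gt0 ?oner_neq0//.
  by rewrite ler_expR lerN2 ler_pM2r// ?ler_sqr ?nnegrE; lra.
by have := gauss_cdf_le1 (x + 1); move: E; rewrite [x + 1]addrC addrK mulr1; rewrite [1 + x]addrC; lra.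
Qed.

End gaussian.

(** * Expectations over finitely many biased coin tosses *)

Section coin.
Context {R : realType}.
Variable p : R.
Hypotheses (p_gt0 : 0 < p) (p_lt1 : p < 1).

(** Recursion on the first toss makes conditioning on it a computation, so that the estimates below
    are inductions on n without integrals. *)
Fixpoint coinE n (f : seq bool -> R) : R :=
  if n is n'.+1 then
    p * coinE n' (fun s => f (true :: s)) + (1 - p) * coinE n' (fun s => f (false :: s))
  else f [::].

(** A random sign minus its mean 2p - 1; [coin_var] is its variance. *)
Definition coin_step (b : bool) : R := if b then 2 * (1 - p) else - (2 * p).
Definition coin_walk (s : seq bool) : R := \sum_(b <- s) coin_step b.
Definition coin_var : R := 4 * p * (1 - p).

Lemma coin_walk_nil : coin_walk [::] = 0.
Proof. by rewrite /coin_walk big_nil. Qed.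

Lemma coin_walk_cons b s : coin_walk (b :: s) = coin_step b + coin_walk s.
Proof. by rewrite /coin_walk big_cons. Qed.

Lemma coin_walk_cat s t : coin_walk (s ++ t) = coin_walk s + coin_walk t.
Proof. by rewrite /coin_walk big_cat. Qed.

Lemma coin_var_gt0 : 0 < coin_var.
Proof. by rewrite /coin_var !mulr_gt0// subr_gt0. Qed.

Lemma coin_var_le1 : coin_var <= 1.
Proof. by rewrite /coin_var; have := sqr_ge0 (2 * p - 1); nra. Qed.

Lemma coinE_le n f g : (forall s, size s = n -> f s <= g s) ->
  coinE n f <= coinE n g.
Proof.
elim: n f g => [|n IH] f g fg /=; first exact: fg.
by rewrite lerD// ler_pM2l ?subr_gt0// IH// => s sn; apply: fg; rewrite /= sn.
Qed.

Lemma eq_coinE n f g : (forall s, size s = n -> f s = g s) ->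
  coinE n f = coinE n g.
Proof.
by move=> fg; apply/le_anti/andP; split; apply: coinE_le => s sn; rewrite fg.
Qed.

Lemma coinEZ n a f : coinE n (fun s => a * f s) = a * coinE n f.
Proof.
elim: n f => //= n IH f.
by rewrite (IH (fun s => f (true :: s))) (IH (fun s => f (false :: s))); ring.
Qed.

Lemma coinED n f g : coinE n (fun s => f s + g s) = coinE n f + coinE n g.
Proof.
elim: n f g => //= n IH f g.
rewrite (IH (fun s => f (true :: s)) (fun s => g (true :: s))).
by rewrite (IH (fun s => f (false :: s)) (fun s => g (false :: s))); ring.
Qed.

Lemma coinE_cst n a : coinE n (fun=> a) = a.
Proof. by elim: n => //= n ->; ring. Qed.

Lemma coinE_cat m n f :
  coinE (m + n) f = coinE m (fun s => coinE n (fun t => f (s ++ t))).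
Proof. by elim: m f => //= m IH f; rewrite !IH. Qed.

(** The form in which the independence of disjoint segments of tosses is used. *)
Lemma coinE_take_drop m n f g :
  coinE (m + n) (fun s => f (take m s) * g (drop m s)) = coinE m f * coinE n g.
Proof.
rewrite coinE_cat mulrC -coinEZ; apply: eq_coinE => s sm.
rewrite mulrC -coinEZ; apply: eq_coinE => t _.
by rewrite take_size_cat// drop_size_cat.
Qed.

Definition coinP n (A : pred (seq bool)) : R := coinE n (fun s => (A s)%:R).

Lemma coinP_ge0 n A : 0 <= coinP n A.
Proof. by rewrite -(coinE_cst n 0); apply: coinE_le => s _. Qed.

Lemma coinP_le n (A B : pred (seq bool)) :
  (forall s, size s = n -> A s -> B s) -> coinP n A <= coinP n B.
Proof.
move=> AB; apply: coinE_le => s /AB.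
by case: (A s) => // /(_ isT) ->.
Qed.

Lemma coinP_le1 n A : coinP n A <= 1.
Proof. by rewrite -(coinE_cst n 1); apply: coinE_le => s _; case: (A s). Qed.

Lemma coinPC n A : coinP n (predC A) = 1 - coinP n A.
Proof.
apply/eqP; rewrite eq_sym subr_eq -(coinE_cst n 1) -coinED; apply/eqP/eq_coinE => s _ /=.
by case: (A s); rewrite /= ?addr0 ?add0r.
Qed.

Lemma coinP_all_blocks r m (A : pred (seq bool)) :
  coinP (m * r) (fun s => all A (reshape (nseq m r) s)) = coinP r A ^+ m.
Proof.
elim: m => [|m IH]; first by rewrite /coinP/= expr0.
rewrite mulSn exprS -IH -coinE_take_drop.
by apply: eq_coinE => s _ /=; rewrite -mulnb natrM.
Qed.

(* Lindeberg's comparison of one step of the walk with the heat flow: [v ^+ 2]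
   is the elapsed time, and one step amounts to letting the time [coin_var] pass. *)
Lemma gauss_cdf_one_step y v : 1 <= v ->
  `|p * gauss_cdf ((y - coin_step true) / v)
    + (1 - p) * gauss_cdf ((y - coin_step false) / v)
    - gauss_cdf (y / Num.sqrt (v ^+ 2 + coin_var))| <= 200 / v ^+ 3.
Proof.
move=> v1; have v0 : 0 < v by lra.
set x := y / v; set c := x * gauss_pdf x.
have c9 : `|c| <= 9 := gauss_pdf_X1 x.
pose w b := - coin_step b / v.
(* Second-order expansion of Phi at x, where the second derivative is -c. The third derivative is at
   most 10 in absolute value and a step at most 2, whence 10 * 2^3 = 80. *)
have step b : `|gauss_cdf (x + w b) - gauss_cdf x - gauss_pdf x * w b
     + c * (w b ^+ 2 / 2)| <= 80 / v ^+ 3.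
  have := @taylor2_le R _ _ _ _ x (w b) 10 is_derive_gauss_cdf is_derive_gauss_pdf
    is_derive2_gauss_pdf (fun y _ => gauss_pdf_derive2_le y).
  rewrite mulNr opprK => /le_trans; apply.
  rewrite /w normrM normrV ?unitfE ?gt_eqF// normrN (gtr0_norm v0) exprMn exprVn.
  rewrite mulrA ler_pM2r ?invr_gt0 ?exprn_gt0//.
  have /(lerXn2r 3) : `|coin_step b| <= 2.
    rewrite /coin_step; case: b; rewrite ler_norml; move: (p_gt0) (p_lt1); lra.
  rewrite !nnegrE normr_ge0 => /(_ isT (ler0n _ 2)); lra.
set a := coin_var / v ^+ 2.
have va : 0 < a by rewrite divr_gt0 ?coin_var_gt0 ?exprn_gt0.
have va1 : a <= v ^- 2.
  by rewrite /a ler_piMl ?invr_ge0 ?exprn_ge0 ?coin_var_le1// ltW.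
have a1 : a <= 1 by rewrite (le_trans va1)// invf_le1 ?exprn_gt0// expr_ge1// ltW.
set r := Num.sqrt (1 + a).
have r2 : r ^+ 2 = 1 + a by rewrite sqr_sqrtr//; lra.
have r0 : 0 <= r := sqrtr_ge0 _.
have r1 : 1 <= r by nra.
have r_le2 : r <= 2 by nra.
have vr : Num.sqrt (v ^+ 2 + coin_var) = v * r.
  rewrite -[v in RHS](ger0_norm (ltW v0)) -sqrtr_sqr -sqrtrM ?sqr_ge0//.
  by congr Num.sqrt; rewrite mulrDr mulr1 mulrC divfK// expf_neq0// gt_eqF.
(* The additional time shrinks the argument of Phi from x to x / r = x (1 - t), and t agrees with a
   / 2 up to a^2. *)
set t := 1 - r^-1.
have t0 : 0 <= t by rewrite /t subr_ge0 invf_le1//; lra.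
have rt : r * t = r - 1 by rewrite /t mulrBr mulr1 divff//; lra.
have t_le : t <= a / 2 by nra.
have tl : `|a / 2 - t| <= a ^+ 2.
  rewrite ler_norml; nra.
have far : `|gauss_cdf (x / r) - gauss_cdf x + c * t| <= 9 * a ^+ 2.
  have xr : x / r = x + (- (x * t)) by rewrite /t; ring.
  (* A point z within |x| t <= |x| / 2 of x has |z| >= |x| / 2, so that |z|^3 phi(z) <= 9 bounds the
     second derivative by 36 / x^2. Here x^2 cancels against the squared increment, which makes the
     error uniform in x. For x = 0 the quotient is 0, and so is z. *)
  have := @taylor1_le R _ _ _ x (- (x * t)) (36 / x ^+ 2)
    is_derive_gauss_cdf is_derive_gauss_pdf.
  rewrite -xr => /(_ _)/le_trans.
  have -> : gauss_pdf x * - (x * t) = - (c * t) by rewrite /c; ring.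
  rewrite opprK; apply.
    move=> z; rewrite normrN normrM (ger0_norm t0) => zx.
    have xz : `|x| <= 2 * `|z|.
      have : `|x| * t <= `|x| / 2 by rewrite ler_wpM2l//; lra.
      by have := lerB_dist x z; rewrite -normrN opprB in zx; lra.
    have [x0|x0] := eqVneq x 0.
      suff -> : z = 0 by rewrite mul0r oppr0 normr0 x0 expr0n/= invr0 mulr0.
      by apply/eqP; move: zx; rewrite x0 subr0 normr0 mul0r normr_le0.
    rewrite normrN normrM (gtr0_norm (gauss_pdf_gt0 z)) ler_pdivlMr; last first.
      by rewrite exprn_even_gt0.
    have : x ^+ 2 <= 4 * `|z| ^+ 2.
      by rewrite -(real_normK (num_real x)); have := normr_ge0 x; nra.
    have := gauss_pdf_X3 z; have := gauss_pdf_gt0 z; have := normr_ge0 z.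
    set A := `|z|; set B := gauss_pdf z => A0 B0 AB xA.
    have /(ler_wpM2l (mulr_ge0 A0 (ltW B0))) := xA; lra.
  have [x0|x0] := eqVneq x 0.
    by rewrite x0 mul0r oppr0 normr0 !expr0n/= mulr0 mulr_ge0 ?sqr_ge0.
  rewrite normrN real_normK ?num_real//.
  have -> : 36 / x ^+ 2 * (x * t) ^+ 2 = 36 * (t * t) by field.
  by have := ler_wpM2l t0 t_le; have := ler_wpM2r (ltW va) t_le; lra.
rewrite vr.
have -> : y / (v * r) = x / r by rewrite /x invfM mulrA.
have v3 : a ^+ 2 <= v ^- 3.
  apply: (@le_trans _ _ (v ^- 4)).
    by rewrite (exprM v 2 2) -(exprVn (v ^+ 2) 2) ler_sqr// nnegrE ?invr_ge0 ?exprn_ge0 ?ltW.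
  by rewrite lef_pV2 ?posrE ?exprn_gt0// ler_weXn2l.
have y_step b : (y - coin_step b) / v = x + w b by rewrite /w mulrBl mulNr.
have wE b : w b = - coin_step b / v by [].
(* First-order terms cancel by the zero mean. Second-order terms add up to -c a / 2, which matches
   the change -c t of the heat flow up to O(a^2). *)
have p_mean : p * w true + (1 - p) * w false = 0.
  by rewrite !wE /coin_step; ring.
have p_var : p * w true ^+ 2 + (1 - p) * w false ^+ 2 = a.
  by rewrite !wE /coin_step /a /coin_var; field; rewrite gt_eqF.
rewrite !y_step; move: (step true) (step false) far tl v3; clearbody w.
set V := v ^- 3; set G := gauss_cdf x; set g := gauss_pdf x.
set T := gauss_cdf (x + w true); set F := gauss_cdf (x + w false).
set Y := gauss_cdf (x / r).
rewrite !ler_norml => /andP[T1 T2] /andP[F1 F2] /andP[Y1 Y2] atl v3.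
have /andP[c1 c2] : - (9 * a ^+ 2) <= c * (a / 2 - t) <= 9 * a ^+ 2.
  by rewrite -ler_norml normrM ler_pM// ler_norml.
have q0 : 0 <= 1 - p by move: (p_lt1); lra.
have := ler_wpM2l (ltW p_gt0) T1; have := ler_wpM2l (ltW p_gt0) T2.
have := ler_wpM2l q0 F1; have := ler_wpM2l q0 F2.
have -> : (1 - p) * (F - G - g * w false + c * (w false ^+ 2 / 2)) =
  (1 - p) * F - (1 - p) * G - g * ((1 - p) * w false) + c / 2 * ((1 - p) * w false ^+ 2).
  by field.
have -> : p * (T - G - g * w true + c * (w true ^+ 2 / 2)) =
  p * T - p * G - g * (p * w true) + c / 2 * (p * w true ^+ 2).
  by field.
have -> : p * w true = - ((1 - p) * w false) by lra.
have -> : p * w true ^+ 2 = a - (1 - p) * w false ^+ 2 by lra.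
have V0 : 0 <= V by rewrite /V invr_ge0 exprn_ge0// ltW.
lra.
Qed.

End coin.

(** * Central limit theorem *)

Section coin_clt.
Context {R : realType}.
Variable p : R.
Hypotheses (p_gt0 : 0 < p) (p_lt1 : p < 1).

Local Notation coinE := (coinE p).
Local Notation coinP := (coinP p).
Local Notation walk := (coin_walk p).
Local Notation var := (coin_var p).

(** The induction hypothesis turns the last n tosses into Gaussian time, which raises the scale from
    v to u. The first toss is then replaced at scale u, at a cost 200 / u^3 <= 200 / v^3. *)
Lemma gauss_cdf_lindeberg n y v : 1 <= v ->
  `|coinE n (fun s => gauss_cdf ((y - walk s) / v))
    - gauss_cdf (y / Num.sqrt (v ^+ 2 + n%:R * var))| <= n%:R * (200 / v ^+ 3).
Proof.
move=> v1; have v0 : 0 < v by lra.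
elim: n y => [|n IH] y /=.
  rewrite coin_walk_nil subr0 !mul0r addr0 sqrtr_sqr (gtr0_norm v0).
  by rewrite subrr normr0.
set u := Num.sqrt (v ^+ 2 + n%:R * var).
have nv0 : 0 <= n%:R * var by rewrite mulr_ge0// ltW// coin_var_gt0.
have u2 : u ^+ 2 = v ^+ 2 + n%:R * var by rewrite sqr_sqrtr// addr_ge0// sqr_ge0.
have vu : v <= u.
  by rewrite -ler_sqr ?u2 ?nnegrE ?sqrtr_ge0 ?(ltW v0)// lerDl.
have u1 : 1 <= u by lra.
have := gauss_cdf_one_step p_gt0 p_lt1 y u1.
rewrite u2 (_ : v ^+ 2 + n%:R * var + var = v ^+ 2 + n.+1%:R * var); last first.
  by rewrite -natr1; ring.
have uv3 : 200 / u ^+ 3 <= 200 / v ^+ 3.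
  rewrite ler_pM2l; last lra.
  by rewrite lef_pV2 ?posrE ?exprn_gt0//; [rewrite lerXn2r ?nnegrE//; lra|lra].
have := IH (y - coin_step p true); have := IH (y - coin_step p false).
rewrite -/u.
have E b : coinE n (fun s => gauss_cdf ((y - walk (b :: s)) / v)) =
    coinE n (fun s => gauss_cdf ((y - coin_step p b - walk s) / v)).
  by apply: eq_coinE => // s _; rewrite coin_walk_cons opprD addrA.
rewrite (E true) (E false) -[n.+1%:R]natr1; move: uv3; clear E IH u2 nv0 vu u1.
set C := 200 / v ^+ 3; set D := 200 / u ^+ 3.
set X := coinE n _; set Y := coinE n _.
clearbody X Y C D.
set G1 := gauss_cdf _; set G2 := gauss_cdf _; set G3 := gauss_cdf _.
clearbody G1 G2 G3; clear u; move: n%:R => N; rewrite !ler_norml => CD /andP[F1 F2] /andP[T1 T2] /andP[S1 S2].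
have q0 : 0 <= 1 - p by move: (p_lt1); lra.
have := ler_wpM2l (ltW p_gt0) T1; have := ler_wpM2l (ltW p_gt0) T2.
have := ler_wpM2l q0 F1; have := ler_wpM2l q0 F2.
lra.
Qed.

Lemma natr_large (B : R) : exists N, forall n, (N <= n)%N -> B <= n%:R.
Proof.
exists (Num.truncn B).+1 => n Nn.
by apply/ltW/(lt_le_trans (truncnS_gt _)); rewrite ler_nat.
Qed.

Lemma sqrt_var_large (B : R) :
  exists N, forall n, (N <= n)%N -> B <= Num.sqrt (n%:R * var).
Proof.
have [N HN] := natr_large (B ^+ 2 / var); exists N => n /HN.
rewrite ler_pdivrMr ?coin_var_gt0// => h.
by rewrite (le_trans (ler_norm _))// -sqrtr_sqr ler_wsqrtr.
Qed.

Lemma coin_clt (x e : R) : 0 < e -> exists N, forall n, (N <= n)%N ->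
  `|coinP n (fun s => walk s <= x * Num.sqrt (n%:R * var)) - gauss_cdf x| <= e.
Proof.
move=> e0; pose h := Num.min (e / 4) 1.
have h0 : 0 < h by rewrite lt_min divr_gt0/=.
have h1 : h <= 1 by rewrite ge_min lexx orbT.
have he : 4 * h <= e.
  have : h <= e / 4 by rewrite ge_min lexx.
  lra.
have [M1 HM1] := gauss_cdf_cvg1 h0; have [M0 HM0] := gauss_cdf_cvg0 h0.
pose M := `|M1| + `|M0| + 1.
have M_1 u : M <= u -> 1 - h <= gauss_cdf u.
  by move=> Mu; apply: HM1; have := ler_norm M1; have := normr_ge0 M0; rewrite /M in Mu; lra.
have M_0 u : u <= - M -> gauss_cdf u <= h.
  move=> Mu; apply: HM0; have := ler_norm (- M0).
  by have := normr_ge0 M1; rewrite normrN /M in Mu *; lra.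
have M1' : 1 <= M by have := normr_ge0 M1; have := normr_ge0 M0; rewrite /M; lra.
pose D := M + `|x| + 1.
have D0 : 0 < D by have := normr_ge0 x; rewrite /D; lra.
(* The smoothing scale in units of the deviation s of the walk. It is so small that M smoothing
   scales are at most h, and that the added variance moves the argument of Phi by at most h. *)
pose sd := h / D.
have sd0 : 0 < sd by rewrite divr_gt0.
have sdD : sd * D = h by rewrite divfK// gt_eqF.
have Mh : M <= h / sd.
  by rewrite ler_pdivlMr//; have := normr_ge0 x; rewrite /D in sdD; nra.
have sd1 : sd <= 1 by have := normr_ge0 x; rewrite /D in sdD; nra.
have xsd : (`|x| + 1) * sd <= h by rewrite /D in sdD; nra.
(* The first term ensures sd * s >= 1; the second brings the accumulated replacement error 200 /
   (sd^3 var s) below h. *)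
have [N HN] := sqrt_var_large (sd^-1 + 200 / (sd ^+ 3 * h * var)).
exists N => n /HN; set s := Num.sqrt (n%:R * var) => sN.
have v0 := coin_var_gt0 p_gt0 p_lt1.
have B0 : 0 < 200 / (sd ^+ 3 * h * var).
  apply: divr_gt0; first lra.
  exact: mulr_gt0 (mulr_gt0 (exprn_gt0 3 sd0) h0) v0.
have sdV0 : 0 < sd^-1 by rewrite invr_gt0.
have s0 : 0 < s by lra.
have s2 : s ^+ 2 = n%:R * var by rewrite sqr_sqrtr// mulr_ge0// ltW.
have v1 : 1 <= sd * s by rewrite mulrC -ler_pdivrMr// mul1r; lra.
have err : n%:R * (200 / (sd * s) ^+ 3) <= h.
  have -> : n%:R * (200 / (sd * s) ^+ 3) = 200 / (sd ^+ 3 * var) / s.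
    have -> : n%:R = s ^+ 2 / var by rewrite s2 mulfK// gt_eqF.
    by field; rewrite !gt_eqF.
  rewrite ler_pdivrMr//.
  have : 200 / (sd ^+ 3 * h * var) <= s by lra.
  rewrite -(ler_pM2l h0); apply: le_trans.
  by rewrite le_eqVlt; apply/orP; left; apply/eqP; field; rewrite !gt_eqF.
set r := Num.sqrt (1 + sd ^+ 2).
have r2 : r ^+ 2 = 1 + sd ^+ 2 by rewrite sqr_sqrtr// addr_ge0// sqr_ge0.
have r0 : 0 <= r := sqrtr_ge0 _.
have r1 : 1 <= r by have := sqr_ge0 sd; nra.
have rsd : r - 1 <= sd by nra.
have sqrtE : Num.sqrt ((sd * s) ^+ 2 + n%:R * var) = s * r.
  rewrite -[RHS]ger0_norm ?mulr_ge0 ?(ltW s0)// -sqrtr_sqr; congr (Num.sqrt _).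
  rewrite exprMn -s2 [RHS]exprMn r2 mulrDr mulr1 addrC.
  by rewrite [sd ^+ 2 * _]mulrC.
clearbody r s sd D M h.
have close u : `|u - x| <= h -> `|gauss_cdf (u / r) - gauss_cdf x| <= 2 * h.
  move=> ux; apply: (le_trans (gauss_cdf_lip _ _)).
  have -> : u / r - x = (u - x) - u * (1 - r^-1) by field; rewrite gt_eqF//; lra.
  have rV : `|1 - r^-1| <= sd.
    have rr : r * r^-1 = 1 by rewrite divff// gt_eqF//; lra.
    have rV0 : 0 <= r^-1 by rewrite invr_ge0.
    by rewrite ler_norml; nra.
  have u1 : `|u| <= `|x| + 1.
    by have := ler_normD (u - x) x; rewrite subrK; lra.
  rewrite (le_trans (ler_normB _ _))// normrM.
  have := ler_pM (normr_ge0 u) (normr_ge0 _) u1 rV; lra.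
have lind y : `|y - x| <= h ->
   `|coinE n (fun t => gauss_cdf ((y * s - walk t) / (sd * s))) - gauss_cdf x| <= 3 * h.
  move=> yx; have := gauss_cdf_lindeberg n (y * s) v1.
  rewrite sqrtE (_ : y * s / (s * r) = y / r); last first.
    by field; rewrite !gt_eqF//; lra.
  have := close _ yx.
  set L := coinE n _; set X := gauss_cdf (y / r).
  by rewrite !ler_norml; lra.
have /lind : `|(x + h) - x| <= h by rewrite addrAC subrr add0r gtr0_norm.
have /lind : `|(x - h) - x| <= h by rewrite addrAC subrr add0r normrN gtr0_norm.
set U := coinE n _; set V := coinE n _.
(* Up to h, the indicator of walk <= x s lies between the smoothed indicators with thresholds (x -
   h) s and (x + h) s. The total error is 3h + h <= e. *)
have FV : coinP n (fun t => walk t <= x * s) <= V + h.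
  rewrite -(coinE_cst p n h) -coinED.
  apply: coinE_le => // t _; case: (leP (walk t)) => /= wt; last first.
    by rewrite addr_ge0 ?(ltW h0)// gauss_cdf_ge0.
  suff /M_1 : M <= ((x + h) * s - walk t) / (sd * s) by lra.
  rewrite (le_trans Mh)// (_ : h / sd = h * s / (sd * s)).
    by rewrite ler_pM2r ?invr_gt0 ?mulr_gt0//; lra.
  by field; rewrite !gt_eqF.
have FU : U <= coinP n (fun t => walk t <= x * s) + h.
  rewrite -(coinE_cst p n h) -coinED.
  apply: coinE_le => // t _; case: (leP (walk t)) => /= wt.
    by have := gauss_cdf_le1 (((x - h) * s - walk t) / (sd * s)); lra.
  rewrite add0r; apply: M_0.
  rewrite lerNr (le_trans Mh)// (_ : h / sd = h * s / (sd * s)).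
    by rewrite -mulNr ler_pM2r ?invr_gt0 ?mulr_gt0//; lra.
  by field; rewrite !gt_eqF.
move: FU FV; set F := coinP n _; rewrite !ler_norml; lra.
Qed.

End coin_clt.

(** * Maximal inequality and exponential tails *)

Section coin_tails.
Context {R : realType}.
Variable p : R.
Hypotheses (p_gt0 : 0 < p) (p_lt1 : p < 1).

Local Notation coinE := (coinE p).
Local Notation coinP := (coinP p).
Local Notation walk := (coin_walk p).
Local Notation var := (coin_var p).

(** Half of the lower bound for the Gaussian tail is sacrificed to the error of the central limit
    theorem. *)
Lemma coin_tail_ge (K : R) : 0 <= K -> exists N, forall n, (N <= n)%N ->
  gauss_pdf (K + 1) / 2 <= coinP n (fun s => K * Num.sqrt (n%:R * var) <= walk s).
Proof.
move=> K0; have g0 : 0 < gauss_pdf (K + 1) / 2 by rewrite divr_gt0 ?gauss_pdf_gt0.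
have [N HN] := coin_clt p_gt0 p_lt1 K g0; exists N => n /HN.
set A := (fun _ : seq bool => _ : bool) => h.
apply: le_trans (_ : coinP n (predC A) <= _); last first.
  by apply: coinP_le => // s _; rewrite /A /= -ltNge => /ltW.
rewrite coinPC//; have := gauss_cdf_tail K0.
by move: h; rewrite ler_norml; lra.
Qed.

(* Whether some prefix of [s], possibly empty, has a walk of at least [x]. *)
Fixpoint crosses (x : R) (s : seq bool) : bool :=
  (x <= 0) || (if s is b :: s' then crosses (x - coin_step p b) s' else false).

Lemma walk_take_crosses x s k : x <= walk (take k s) -> crosses x s.
Proof.
elim: s x k => [|b s IH] x [|k] /=; rewrite ?take0 ?coin_walk_nil ?orbF// => h.
  by rewrite h.
by rewrite (IH _ k) ?orbT// lerBlDl -coin_walk_cons.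
Qed.

Definition coin_mgf (l : R) : R :=
  p * expR (l * coin_step p true) + (1 - p) * expR (l * coin_step p false).

Lemma coin_mgf_ge1 l : 1 <= coin_mgf l.
Proof.
have := ler_wpM2l (ltW p_gt0) (expR_ge1Dx (l * coin_step p true)).
have q0 : 0 <= 1 - p by move: (p_lt1); lra.
have := ler_wpM2l q0 (expR_ge1Dx (l * coin_step p false)).
by rewrite /coin_mgf; set E1 := expR _; set E2 := expR _; rewrite /coin_step; lra.
Qed.

(** The maximal inequality for the exponential martingale, by conditioning on the first toss, which
    shifts the level x by a step. If x <= 0 the bound is at least 1, since [coin_mgf l] is. *)
Lemma coin_maximal n l x : 0 <= l ->
  coinP n (crosses x) <= expR (- (l * x)) * coin_mgf l ^+ n.
Proof.
move=> l0; have mge := exprn_ege1 _ (coin_mgf_ge1 l).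
elim: n x => [|n IH] x.
  rewrite /coinP/= orbF expr0 mulr1; have [x0|_] := leP x 0 => /=.
    by rewrite -[leLHS]expR0 ler_expR oppr_ge0 mulr_ge0_le0.
  exact: expR_ge0.
have [x0|x0] := leP x 0.
  rewrite (le_trans (coinP_le1 p_gt0 p_lt1 _ _))// mulr_ege1 ?mge//.
  by rewrite -expR0 ler_expR oppr_ge0 mulr_ge0_le0.
have E b : coinE n (fun s => (crosses x (b :: s))%:R) = coinP n (crosses (x - coin_step p b)).
  by apply: eq_coinE => // s _ /=; rewrite leNgt x0.
rewrite {1}/coinP/= -/(coinE _ _) (E true) (E false).
have := ler_wpM2l (ltW p_gt0) (IH (x - coin_step p true)).
have q0 : 0 <= 1 - p by move: (p_lt1); lra.
have := ler_wpM2l q0 (IH (x - coin_step p false)).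
have F b : expR (- (l * (x - coin_step p b))) = expR (- (l * x)) * expR (l * coin_step p b).
  by rewrite -expRD; congr expR; ring.
rewrite (F true) (F false) exprS {3}/coin_mgf => h1 h2.
apply: (le_trans (lerD h2 h1)).
by rewrite le_eqVlt; apply/orP; left; apply/eqP; ring.
Qed.

Lemma expR_1_le4 : expR (1 : R) <= 4.
Proof.
have h : 1 / 2 <= expR (- (1 / 2)) :> R by apply: le_trans (expR_ge1Dx _); lra.
have E : expR (1 : R) * (expR (- (1 / 2)) * expR (- (1 / 2))) = 1.
  by rewrite -!expRD -[RHS]expR0; congr expR; lra.
have b4 := ler_pM (ltac:(lra) : 0 <= 1 / 2 :> R) (ltac:(lra) : 0 <= 1 / 2 :> R) h h.
by have := ler_wpM2l (expR_ge0 (1 : R)) b4; rewrite E; lra.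
Qed.

(** Second-order expansion of exp at 0: the exponent stays in [-1, 1], where the third derivative is
    at most e <= 4, and 4 * 2^3 = 32. The mean vanishes and the variance gives the quadratic
    term. *)
Lemma coin_mgf_le (l : R) : 0 <= l <= 1 / 2 ->
  coin_mgf l <= expR (var * l ^+ 2 / 2 + 32 * l ^+ 3).
Proof.
move=> /andP[l0 l2]; apply: le_trans (expR_ge1Dx _).
have step b : expR (l * coin_step p b) <=
    1 + l * coin_step p b + (l * coin_step p b) ^+ 2 / 2 + 32 * l ^+ 3.
  have z2 : `|coin_step p b| <= 2.
    by rewrite /coin_step; case: b; rewrite ler_norml; move: (p_gt0) (p_lt1); lra.
  have w1 : `|l * coin_step p b| <= 1.
    by rewrite normrM (ger0_norm l0); have := normr_ge0 (coin_step p b); nra.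
  have := @taylor2_le R _ _ _ _ 0 (l * coin_step p b) 4
    (@is_derive_expR R) (@is_derive_expR R) (@is_derive_expR R).
  rewrite add0r expR0 !mul1r => /(_ _)/le_trans h.
  have {}h : `|expR (l * coin_step p b) - 1 - l * coin_step p b -
    (l * coin_step p b) ^+ 2 / 2| <= 32 * l ^+ 3.
    apply: h => [y|]; first rewrite subr0 => y1.
      rewrite gtr0_norm ?expR_gt0// (le_trans _ expR_1_le4)// ler_expR.
      by rewrite (le_trans (ler_norm _))// (le_trans y1).
    rewrite normrM (ger0_norm l0) exprMn.
    have : `|coin_step p b| ^+ 3 <= 2 ^+ 3 by rewrite lerXn2r// nnegrE; lra.
    by move=> /(ler_wpM2l (exprn_ge0 3 l0)); lra.
  by move: h; rewrite ler_norml; lra.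
have q0 : 0 <= 1 - p by move: (p_lt1); lra.
have := ler_wpM2l (ltW p_gt0) (step true); have := ler_wpM2l q0 (step false).
rewrite /coin_mgf; set E1 := expR _; set E2 := expR _; rewrite /coin_step /coin_var.
lra.
Qed.

Lemma coin_maximal_le n (V l x : R) : 0 <= l <= 1 / 2 -> n%:R <= V ->
  coinP n (crosses x) <= expR (- (l * x) + V * (var * l ^+ 2 / 2 + 32 * l ^+ 3)).
Proof.
move=> l01 nV; have /andP[l0 _] := l01.
apply: (le_trans (coin_maximal _ _ l0)); rewrite expRD ler_pM2l ?expR_gt0//.
apply: (@le_trans _ _ (expR (var * l ^+ 2 / 2 + 32 * l ^+ 3) ^+ n)).
  rewrite lerXn2r ?nnegrE ?expR_ge0 ?coin_mgf_le//.
  exact: le_trans (coin_mgf_ge1 l).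
rewrite -expRM_natl ler_expR ler_wpM2r// addr_ge0//.
  by rewrite divr_ge0// mulr_ge0 ?sqr_ge0 ?(ltW (coin_var_gt0 p_gt0 p_lt1)).
by rewrite mulr_ge0 ?exprn_ge0.
Qed.

End coin_tails.

(** * Exponential bounds on geometric blocks *)

Section lil_upper_tail.
Context {R : realType}.
Variable p : R.
Hypotheses (p_gt0 : 0 < p) (p_lt1 : p < 1).

Local Notation coinP := (coinP p).
Local Notation var := (coin_var p).

(** Since [var] is 4p(1 - p), this is the normalisation of (c). The argument is real so that it can
    be a block endpoint exp(k L). *)
Definition lil_norm (n : R) : R := Num.sqrt (2 * var * n * ln (ln n)).

Lemma lil_norm_le (m n : R) : 0 <= m <= n -> 0 <= ln (ln m) <= ln (ln n) ->
  lil_norm m <= lil_norm n.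
Proof.
move=> /andP[m0 mn] /andP[l0 ll]; rewrite /lil_norm ler_wsqrtr//.
have v0 := coin_var_gt0 p_gt0 p_lt1.
have v20 : 0 <= 2 * var by lra.
by rewrite -[leLHS]mulrA -[leRHS]mulrA ler_wpM2l// ler_pM.
Qed.

(** With l = ln(k L), the level contributes -2 (1 + e) l to the exponent and the variance (1 + e) l.
    The cubic term costs at most e l / 2, which leaves -(1 + e / 2) l, a summable power of k. *)
Lemma lil_block_bound (e : R) : 0 < e -> e <= 1 -> let L := ln (1 + e) in
  exists k0 : nat, forall k, (k0 <= k)%N ->
  expR 1 <= k%:R * L /\ forall n, n%:R <= expR (k.+1%:R * L) ->
  coinP n (crosses p ((1 + e) * lil_norm (expR (k%:R * L)))) <=
  expR (- ((1 + e / 2) * ln (k%:R * L))).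
Proof.
move=> e0 e1 L.
have L0 : 0 < L by rewrite ln_gt0//; lra.
have v0 : 0 < var := coin_var_gt0 p_gt0 p_lt1.
(* An upper bound for the exponential parameter [la]: the moment bound then applies and its cubic
   term is small compared with e l. *)
pose c := Num.min (1 / 2) (var * e / 256).
have ve0 : 0 < var * e / 256 by apply: divr_gt0; [exact: mulr_gt0|lra].
have c0 : 0 < c by rewrite lt_min ve0 andbT; lra.
have c2 : c <= 1 / 2 by rewrite ge_min lexx.
have cve : c <= var * e / 256 by rewrite ge_min lexx orbT.
have c22 : 0 < c ^+ 2 by rewrite exprn_gt0.
have [k1 H1] := natr_large (expR 1 / L).
have [k2 H2] := natr_large (4 / (L * var * c ^+ 2)).
exists (maxn k1 k2) => k; rewrite geq_max => /andP[/H1 + /H2].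
have D0 := mulr_gt0 (mulr_gt0 L0 v0) c22.
rewrite (ler_pdivrMr _ _ D0) (ler_pdivrMr _ _ L0); set y := k%:R * L => ey ky.
have {}ky : 4 <= y * var * c ^+ 2 by rewrite /y; lra.
have y0 : 0 < y by rewrite (lt_le_trans (expR_gt0 1)).
split=> // n; rewrite -natr1 mulrDl mul1r -/y expRD [expR L]lnK ?posrE; last lra.
move=> nV.
set l := ln y; set w := expR y in nV *.
have l1 : 1 <= l by rewrite /l -[leLHS]expRK ler_ln ?posrE ?expR_gt0.
have ly : l <= y by rewrite ltW// ln_sublinear.
have w0 : 0 < w := expR_gt0 _.
have wy : y ^+ 2 / 2 <= w.
  apply: le_trans (expR_ge1Dxn 1 (ltW y0)).
  by rewrite (_ : 2`!%:R = 2 :> R)//; lra.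
rewrite /lil_norm expRK -/l.
set x := Num.sqrt _.
have x2 : x ^+ 2 = 2 * var * w * l.
  by rewrite sqr_sqrtr//; apply: mulr_ge0; [apply: mulr_ge0|]; rewrite ?(ltW w0)//; lra.
have x0 : 0 <= x := sqrtr_ge0 _.
(* The minimiser of -la x + w var la^2 / 2. *)
pose la := x / (w * var).
have wv0 : 0 < w * var := mulr_gt0 w0 v0.
have la0 : 0 <= la by rewrite divr_ge0// ltW.
have la2 : la ^+ 2 * (w * var) = 2 * l.
  by rewrite /la exprMn x2; field; rewrite !gt_eqF.
have lax : la * x = 2 * l.
  by rewrite /la mulrAC -expr2 x2; field; rewrite !gt_eqF.
clearbody l w la x c y L.
have lac : la <= c.
  rewrite -ler_sqr ?nnegrE ?(ltW c0)//.
  have : y * (la ^+ 2 * var) <= 4.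
    have : y ^+ 2 * (la ^+ 2 * var) <= 4 * y.
      have a0 : 0 <= la ^+ 2 * var := mulr_ge0 (sqr_ge0 _) (ltW v0).
      have := ler_wpM2r a0 wy; lra.
    by move=> ya; rewrite -(ler_pM2l y0); lra.
  have yv0 : 0 < y * var := mulr_gt0 y0 v0.
  by move=> ya; rewrite -(ler_pM2l yv0); lra.
have la01 : 0 <= la <= 1 / 2 by rewrite la0/=; lra.
have nV' : n%:R <= (1 + e) * w by rewrite mulrC.
apply: (le_trans (coin_maximal_le p_gt0 p_lt1 _ la01 nV')).
rewrite ler_expR.
have -> : - (la * ((1 + e) * x)) = - ((1 + e) * (2 * l)) by rewrite -lax; ring.
have -> : (1 + e) * w * (var * la ^+ 2 / 2 + 32 * la ^+ 3) =
  (1 + e) * (l + 32 * la * (w * la ^+ 2)).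
  have -> : l = la ^+ 2 * (w * var) / 2 by lra.
  by field.
have lw : la * (w * la ^+ 2) <= e * l / 128.
  have -> : w * la ^+ 2 = 2 * l / var by rewrite -la2; field; rewrite gt_eqF.
  have l20 : 0 <= 2 * l / var by apply: divr_ge0; lra.
  have := ler_wpM2r l20 (le_trans lac cve).
  have -> : var * e / 256 * (2 * l / var) = e * l / 128 by field; rewrite gt_eqF.
  done.
have e10 : 0 <= 1 + e by lra.
have := ler_wpM2l e10 lw.
have el0 : 0 <= e * l by rewrite mulr_ge0//; lra.
have : e * (e * l) <= e * l by rewrite ler_piMl.
lra.
Qed.

(** Comparison of x^(-1-s) with its integral over [x - 1, x], powers being written as exponentials.
    It follows from ln(x - 1) <= ln x - 1/x and turns the block probabilities into a telescoping
    series. *)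
Lemma riemann_telescope (s x : R) : 0 < s -> 1 < x ->
  expR (- ((1 + s) * ln x)) <=
  s^-1 * (expR (- (s * ln (x - 1))) - expR (- (s * ln x))).
Proof.
move=> s0 x1; have x0 : 0 < x by lra.
rewrite ler_pdivlMl//.
have -> : - ((1 + s) * ln x) = - (s * ln x) + - ln x by ring.
rewrite expRD [expR (- ln x)]expRN [expR (ln x)]lnK ?posrE//.
have lnx : ln (x - 1) <= ln x - x^-1.
  have -> : x - 1 = x * (1 + - x^-1) by field; rewrite gt_eqF.
  have xV : x^-1 < 1 by rewrite invf_lt1.
  rewrite lnM ?posrE//; last lra.
  by rewrite lerD2l le_ln1Dx//; lra.
have : expR (- (s * ln x)) * (1 + s / x) <= expR (- (s * ln (x - 1))).
  apply: (@le_trans _ _ (expR (- (s * ln x)) * expR (s / x))).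
    by rewrite ler_pM2l ?expR_gt0// expR_ge1Dx.
  rewrite -expRD ler_expR.
  by have := ler_wpM2l (ltW s0) lnx; lra.
lra.
Qed.

End lil_upper_tail.

(** * Independent biased bits and Borel-Cantelli lemmas *)

Section borel_cantelli_real.
Context d (T : measurableType d) (R : realType) (P : probability T R).

(** First Borel-Cantelli lemma: the partial sums of the probabilities from k0 on telescope and are
    at most [v k0]. *)
Lemma borel_cantelli_telescope (F : nat -> set T) (v : nat -> R) (k0 : nat) :
  (forall k, measurable (F k)) -> (forall k, (k0 <= k)%N -> 0 <= v k) ->
  (forall k, (k0 <= k)%N -> (P (F k) <= (v k - v k.+1)%:E)%E) ->
  \forall w \ae P, exists K, forall k, (K <= k)%N -> ~ F k w.
Proof.
move=> mF v0 PF; pose G k := F (k0 + k)%N.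
have mG k : measurable (G k) by exact: mF.
exists (lim_sup_set G); split.
- by apply: bigcap_measurable => // k _; exact: bigcup_measurable.
- apply: lim_sup_set_cvg0 => //; apply: (@le_lt_trans _ _ (v k0)%:E); last exact: ltry.
  apply: lime_le.
    by apply: is_cvg_ereal_nneg_natsum => k _; exact: measure_ge0.
  apply: nearW => n.
  apply: (@le_trans _ _ (v k0 - v (k0 + n)%N)%:E); last first.
    by rewrite lee_fin gerBl v0// leq_addr.
  elim: n => [|n IH]; first by rewrite big_geq// addn0 subrr.
  rewrite big_nat_recr//= (le_trans (leeD IH (PF _ (leq_addr _ _))))//.
  by rewrite -EFinD lee_fin addnS; lra.
- move=> w /= h k _; apply: contrapT => nG; apply: h.
  exists (k0 + k)%N => j kj Fj; apply: nG.
  have k0j : (k0 <= j)%N by apply: leq_trans kj; exact: leq_addr.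
  by exists (j - k0)%N; [rewrite /= leq_subRL|rewrite /G subnKC].
Qed.

End borel_cantelli_real.

Section iid_bits.
Context d (T : measurableType d) (R : realType) (P : probability T R) (p : R).
Hypotheses (p_gt0 : 0 < p) (p_lt1 : p < 1).

Definition bits (b : nat -> T -> bool) (m n : nat) (w : T) : seq bool :=
  [seq b i w | i <- iota m n].

(** Independence and the common law are encoded together, by the probability of every initial
    word. *)
Definition iid_bits (b : nat -> T -> bool) : Prop :=
  (forall i, measurable [set w | b i w]) /\
  forall s : seq bool, P [set w | bits b 0 (size s) w = s] =
    (\prod_(c <- s) (if c then p else 1 - p))%:E.

Variable b : nat -> T -> bool.
Hypothesis iid_b : iid_bits b.

Lemma size_bits m n w : size (bits b m n w) = n.
Proof. by rewrite size_map size_iota. Qed.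

Lemma bitsS m n w : bits b m n.+1 w = b m w :: bits b m.+1 n w.
Proof. by []. Qed.

Lemma bits_cat m n k w : bits b m (n + k) w = bits b m n w ++ bits b (m + n) k w.
Proof. by rewrite /bits iotaD map_cat. Qed.

Lemma take_bits m n k w : (n <= k)%N -> take n (bits b m k w) = bits b m n w.
Proof. by move=> /subnKC <-; rewrite bits_cat take_size_cat ?size_bits. Qed.

Lemma drop_bits m n k w : drop n (bits b m (n + k) w) = bits b (m + n) k w.
Proof. by rewrite bits_cat drop_size_cat ?size_bits. Qed.

Lemma slice_bits m n k w : (m <= n)%N -> (n <= k)%N ->
  take (n - m) (drop m (bits b 0 k w)) = bits b m (n - m) w.
Proof.
move=> mn nk; rewrite take_drop subnK// take_bits//.
by rewrite -{1}(subnKC mn) drop_bits.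
Qed.

Lemma measurable_bits m n (A : seq bool -> Prop) :
  measurable [set w | A (bits b m n w)].
Proof.
elim: n m A => [|n IH] m A.
  by have [a|a] := pselect (A [::]);
    [rewrite (_ : mkset _ = setT)|rewrite (_ : mkset _ = set0)] => //;
    apply/seteqP; split.
have mb := iid_b.1 m.
rewrite (_ : mkset _ = ([set w | b m w] `&` [set w | A (true :: bits b m.+1 n w)]) `|`
   (~` [set w | b m w] `&` [set w | A (false :: bits b m.+1 n w)])).
  by apply: measurableU; apply: measurableI => //;
    [exact: (IH m.+1 (fun s => A (true :: s)))|exact: measurableC
    |exact: (IH m.+1 (fun s => A (false :: s)))].
apply/seteqP; split => w /=; rewrite bitsS.
  by case: (b m w) => h; [left|right].
by case=> -[]; [move=> ->|move=> /negP/negbTE ->].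
Qed.

(** The prefix s is kept general so that the induction on n can move the next bit into it, matching
    the recursion of [coinE]. *)
Lemma prob_bits_cylinder (s : seq bool) n (A : pred (seq bool)) :
  P [set w | bits b 0 (size s) w = s /\ A (bits b (size s) n w)] =
  ((\prod_(c <- s) (if c then p else 1 - p)) * coinP p n A)%:E.
Proof.
elim: n s A => [|n IH] s A.
  rewrite /coinP /=; have [a|a] := boolP (A [::]).
    by rewrite mulr1 -iid_b.2; congr (P _); apply/seteqP; split => w /= [].
  by rewrite mulr0 (_ : mkset _ = set0) ?measure0//; apply/seteqP; split => w /= [].
have mc c : measurable [set w | bits b 0 (size s) w = s /\ A (bits b (size s) n.+1 w)
    /\ b (size s) w = c].
  have := measurable_bits 0 (size s + n.+1)
    (fun t => take (size s) t = s /\ A (drop (size s) t) /\ head true (drop (size s) t) = c).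
  by under eq_set do rewrite take_bits ?leq_addr// drop_bits add0n bitsS/= -bitsS.
have E c : P [set w | bits b 0 (size s) w = s /\ A (bits b (size s) n.+1 w)
      /\ b (size s) w = c] =
    ((\prod_(c <- rcons s c) (if c then p else 1 - p)) *
      coinP p n (fun t => A (c :: t)))%:E.
  rewrite -IH; congr (P _); apply/seteqP; split => w /=;
    rewrite bitsS size_rcons -[(size s).+1]addn1 bits_cat/= cats1.
    by move=> [-> [+ <-]].
  by move=> [/rcons_inj[-> <-]].
rewrite (_ : mkset _ = [set w | bits b 0 (size s) w = s /\
      A (bits b (size s) n.+1 w) /\ b (size s) w = true] `|`
    [set w | bits b 0 (size s) w = s /\
      A (bits b (size s) n.+1 w) /\ b (size s) w = false]).
  rewrite measureU//=; last by apply/seteqP; split => w //= [[_ [_ ->]] []] _ [].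
  rewrite !E -EFinD; congr EFin.
  by rewrite -!cats1 !big_cat !big_seq1 /coinP/=; ring.
apply/seteqP; split => w /=.
  by move=> [h1 h2]; case E' : (b (size s) w); [left|right].
by case=> [] [? []].
Qed.

Lemma prob_bits m n (A : pred (seq bool)) :
  P [set w | A (bits b m n w)] = (coinP p n A)%:E.
Proof.
have := prob_bits_cylinder [::] (m + n) (fun t => A (drop m t)).
rewrite big_nil mul1r (_ : coinP _ _ _ = coinP p n A).
  move=> <-; congr (P _); apply/seteqP; split => w /=; rewrite drop_bits add0n//.
  by case.
have := coinE_take_drop p_gt0 p_lt1 m n (fun=> 1) (fun t => (A t)%:R).
rewrite /coinP coinE_cst mul1r => <-; apply: eq_coinE => // s _.
by rewrite mul1r.
Qed.

(** Second Borel-Cantelli lemma: the blocks are disjoint, so no event among K, ..., K + n - 1 occurs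
    with probability at most the product of the 1 - P(A_k), hence at most exp(- sum of P(A_k)). *)
Lemma borel_cantelli_blocks (s : nat -> nat) (A : nat -> pred (seq bool)) k0 :
  (forall k, s k <= s k.+1)%N ->
  (forall K (M : R), (k0 <= K)%N -> exists n,
    M <= \sum_(K <= k < K + n) coinP p (s k.+1 - s k) (A k)) ->
  \forall w \ae P, forall K, exists2 k, (K <= k)%N & A k (bits b (s k) (s k.+1 - s k) w).
Proof.
move=> s_homo sumA.
have {}s_homo : {homo s : i j / (i <= j)%N} by apply: homo_leq => //; exact: leq_trans.
(* The absence of these events is expressed on one finite word, so that [coinP] can evaluate it. *)
pose Q K n t := all (fun k => ~~ A k (take (s k.+1 - s k) (drop (s k) t))) (iota K n).
have PQ K n : coinP p (s (K + n)%N) (Q K n) <=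
    expR (- \sum_(K <= k < K + n) coinP p (s k.+1 - s k) (A k)).
  elim: n => [|n IH].
    by rewrite addn0 big_geq// oppr0 expR0 coinP_le1.
  rewrite addnS; have sS := s_homo _ _ (leqnSn (K + n)).
  rewrite big_nat_recr/= ?leq_addr// opprD expRD -[in leLHS](subnKC sS).
  rewrite (_ : coinP _ _ _ = coinP p (s (K + n)%N) (Q K n) *
      coinP p (s (K + n).+1%N - s (K + n)%N) (predC (A (K + n)%N))).
    rewrite coinPC// ler_pM ?coinP_ge0 ?subr_ge0 ?coinP_le1//.
    exact: expR_ge1Dx.
  rewrite /coinP -coinE_take_drop//; apply: eq_coinE => // t st.
  rewrite /Q -addn1 iotaD all_cat /= andbT -natrM mulnb.
  rewrite [in X in _ && X](@take_oversize _ _ (drop _ _)) ?size_drop ?st ?addKn//.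
  congr ((_ && _)%:R); apply: eq_in_all => k; rewrite mem_iota => /andP[_ kKn].
  have skn : (s k.+1 <= s (K + n)%N)%N by exact: s_homo.
  have skk : (s k <= s k.+1)%N by exact: s_homo.
  by rewrite !take_drop subnK// take_takel.
apply: ae_foralln => K0; pose K := maxn K0 k0.
have K0K : (K0 <= K)%N := leq_maxl _ _.
pose Z := [set w | forall k, (K <= k)%N -> ~ A k (bits b (s k) (s k.+1 - s k) w)].
have mZ : measurable Z.
  rewrite (_ : Z = \bigcap_(k in [set k | (K <= k)%N])
     [set w | ~ A k (bits b (s k) (s k.+1 - s k) w)]).
    by apply: bigcap_measurable => [|k _]; [exists K => /=|exact: (measurable_bits _ _ (fun t => ~ A k t))].
  by apply/seteqP; split.
exists Z; split => //.
- apply/eqP; rewrite eq_le measure_ge0 andbT; apply/lee_addgt0Pr => e e0.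
  have [n] := sumA K (- ln e) (leq_maxr _ _); rewrite add0e -lerN2 opprK -ler_expR lnK ?posrE// => hn.
  apply: (@le_trans _ _ (P [set w | Q K n (bits b 0 (s (K + n)%N) w)])).
    apply: le_measure; rewrite ?inE//; first exact: (measurable_bits _ _ (Q K n)).
    move=> w Zw /=; apply/allP => k; rewrite mem_iota => /andP[Kk kn].
    by rewrite slice_bits ?s_homo//; apply/negP/Zw.
  by rewrite prob_bits lee_fin (le_trans (PQ K n)).
- move=> w /= h k Kk Ak; apply: h.
  by exists k => //; apply: leq_trans Kk.
Qed.

End iid_bits.

(** * Law of the iterated logarithm, upper half *)

Section lil_upper.
Context d (T : measurableType d) (R : realType) (P : probability T R).

(** Eventually no block k has a crossing of (1 + e) times the norm at its left end exp(k L). Each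
    large n lies in a block, and the norm at n is at least the one at the left end. *)
Lemma lil_upper (p : R) (b : nat -> T -> bool) (e : R) :
  0 < p -> p < 1 -> iid_bits P p b -> 0 < e ->
  \forall w \ae P, exists N, forall n, (N <= n)%N ->
    coin_walk p (bits b 0 n w) <= (1 + e) * lil_norm p n%:R.
Proof.
move=> p0 p1 iid_b; wlog e1 : e / e <= 1 => [wlg|] e0.
  have [/wlg/(_ e0)//|e1] := leP e 1.
  apply: filterS (wlg 1 (lexx _) ltr01) => w [N HN]; exists N => n Nn.
  by rewrite (le_trans (HN _ Nn))// ler_wpM2r ?sqrtr_ge0//; lra.
have := lil_block_bound p0 p1 e0 e1; set L := ln (1 + e) => -[k0 Hk0].
have L0 : 0 < L by rewrite ln_gt0//; lra.
pose x k := (1 + e) * lil_norm p (expR (k%:R * L)).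
pose V k := Num.truncn (expR (k.+1%:R * L)).
pose F k := [set w | crosses p (x k) (bits b 0 (V k) w)].
pose s := e / 2; have s0 : 0 < s by rewrite /s; lra.
pose C := expR (- ((1 + s) * ln L)).
(* Since ln(k L) = ln k + ln L, the factor [C] carries the power of L, and the rest is the
   telescoping bound of [riemann_telescope]. *)
pose v k := C * (s^-1 * expR (- (s * ln (k%:R - 1)))).
have mF k : measurable (F k) by exact: (measurable_bits iid_b _ _ (crosses p (x k))).
have v0 k : (maxn k0 2 <= k)%N -> 0 <= v k.
  by move=> _; rewrite /v !mulr_ge0 ?expR_ge0// invr_ge0 ltW.
have PF k : (maxn k0 2 <= k)%N -> (P (F k) <= (v k - v k.+1)%:E)%E.
  rewrite geq_max => /andP[/Hk0[eL Hk] k2].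
  rewrite (prob_bits p0 p1 iid_b) lee_fin.
  have Vk : (V k)%:R <= expR (k.+1%:R * L) by rewrite truncn_le ?expR_ge0.
  apply: (le_trans (Hk _ Vk)).
  have k1 : 1 < k%:R :> R by rewrite ltr1n.
  have := riemann_telescope s0 k1.
  rewrite lnM ?posrE//; last lra.
  have -> : - ((1 + e / 2) * (ln k%:R + ln L)) =
    - ((1 + s) * ln L) + - ((1 + s) * ln k%:R) by rewrite /s; ring.
  rewrite expRD -/C => /(ler_wpM2l (expR_ge0 (- ((1 + s) * ln L)))).
  rewrite -/C => /le_trans; apply.
  by rewrite le_eqVlt; apply/orP; left; apply/eqP; rewrite /v -natr1 addrK; ring.
apply: filterS (borel_cantelli_telescope mF v0 PF) => w [K HK].
pose k1 := maxn k0 K.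
have [N HN] := @natr_large R (expR (k1%:R * L)).
exists N => n Nn; have nk1 := HN _ Nn.
have n0 : 0 < n%:R :> R := lt_le_trans (expR_gt0 _) nk1.
have kn : k1%:R * L <= ln n%:R by rewrite -ler_expR lnK ?posrE.
pose k := Num.truncn (ln n%:R / L).
have lnL0 : 0 <= ln n%:R / L.
  by rewrite divr_ge0 ?(ltW L0)// (le_trans _ kn)// mulr_ge0 ?(ltW L0).
have /andP[kl lk] := truncn_itv lnL0; rewrite -/k in kl lk.
have k1k : (k1 <= k)%N by rewrite truncn_ge_nat// ler_pdivlMr.
have /andP[k0k Kk] : (k0 <= k)%N && (K <= k)%N by rewrite -geq_max.
have [eL _] := Hk0 _ k0k.
rewrite ler_pdivlMr// in kl; rewrite ltr_pdivrMr// in lk.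
have y0 : 0 < k%:R * L := lt_le_trans (expR_gt0 1) eL.
have nV : (n <= V k)%N.
  rewrite truncn_ge_nat ?expR_ge0//.
  by rewrite -[leLHS]lnK ?posrE// ler_expR ltW.
have /negP xw := HK _ Kk; rewrite leNgt; apply/negP => h; case/negP: xw.
apply: (@walk_take_crosses _ _ _ _ n); rewrite take_bits//; apply: le_trans (ltW h).
rewrite ler_pM2l; last lra.
have lnn0 := lt_le_trans y0 kl.
apply: lil_norm_le => //.
  by rewrite expR_ge0/= -[leRHS]lnK ?posrE// ler_expR.
rewrite expRK; apply/andP; split.
  rewrite -[leLHS](@ln1 R) ler_ln ?posrE//.
  by apply: le_trans eL; rewrite -[leLHS]expR0 ler_expR.
by rewrite ler_ln ?posrE.
Qed.

Lemma bits_flip (b : nat -> T -> bool) m n w :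
  bits (fun i w => ~~ b i w) m n w = map negb (bits b m n w).
Proof. by rewrite /bits -map_comp. Qed.

(** Exchanging the two faces replaces p by 1 - p and the walk by its negative, so upper bounds also
    yield lower ones. *)
Lemma iid_bits_flip (p : R) (b : nat -> T -> bool) : iid_bits P p b ->
  iid_bits P (1 - p) (fun i w => ~~ b i w).
Proof.
move=> [mb Pb]; split=> [i|s].
  rewrite (_ : mkset _ = ~` [set w | b i w]); first exact: measurableC.
  by apply/seteqP; split => w /= /negP.
rewrite (_ : mkset _ = [set w | bits b 0 (size (map negb s)) w = map negb s]).
  rewrite Pb big_map; congr EFin; apply: eq_bigr => -[] _ //=; lra.
apply/seteqP; split => w /=; rewrite size_map bits_flip.
  by move=> {2}<-; rewrite -map_comp map_id_in// => c _; rewrite /= negbK.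
by move=> ->; rewrite -map_comp map_id_in// => c _; rewrite /= negbK.
Qed.

Lemma coin_walk_flip (p : R) s : coin_walk (1 - p) (map negb s) = - coin_walk p s.
Proof.
rewrite /coin_walk big_map -sumrN; apply: eq_bigr => -[] _; rewrite /coin_step/=; lra.
Qed.

Lemma lil_norm_flip (p n : R) : lil_norm (1 - p) n = lil_norm p n.
Proof. by rewrite /lil_norm /coin_var; congr Num.sqrt; ring. Qed.

Lemma lil_upper_opp (p : R) (b : nat -> T -> bool) (e : R) :
  0 < p -> p < 1 -> iid_bits P p b -> 0 < e ->
  \forall w \ae P, exists N, forall n, (N <= n)%N ->
    - ((1 + e) * lil_norm p n%:R) <= coin_walk p (bits b 0 n w).
Proof.
move=> p0 p1 /iid_bits_flip iid_b e0.
have q0 : 0 < 1 - p by lra.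
have q1 : 1 - p < 1 by lra.
apply: filterS (lil_upper q0 q1 iid_b e0) => w [N HN]; exists N => n /HN.
by rewrite bits_flip coin_walk_flip lil_norm_flip lerNl.
Qed.

End lil_upper.

(** * Law of the iterated logarithm, lower half *)

Section lil_lower_schedule.
Context {R : realType}.

Lemma gauss_pdf_rate (e : R) : 0 < e -> e <= 1 -> exists K kap : R,
  [/\ 0 <= K, 1 <= kap, expR (- kap) <= gauss_pdf (K + 1) / 2 &
      (1 - e / 4) * (2 * kap) <= K ^+ 2].
Proof.
move=> e0 e1; pose c0 := - ln (normal_peak (1 : R) / 2).
have pk0 : 0 < normal_peak (1 : R) / 2 by rewrite divr_gt0 ?normal_peak_gt0 ?oner_neq0.
have c00 : 0 <= c0.
  by rewrite oppr_ge0 ln_le0//; have := @normal_peak1_le1 R; lra.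
(* With kap = (K + 1)^2 / 2 + c0 one has 2 kap = K^2 + 2K + 1 + 2 c0, and the saving (e / 4) K^2 =
   (3 + 2 c0) K covers the lower-order terms. *)
pose K := (3 + 2 * c0) / (e / 4).
have Ke : e / 4 * K = 3 + 2 * c0 by rewrite /K; field; rewrite gt_eqF.
have K1 : 1 <= K by rewrite /K ler_pdivlMr; lra.
exists K, ((K + 1) ^+ 2 / 2 + c0); split; first lra.
- by have := sqr_ge0 K; nra.
- rewrite gauss_pdfE opprD expRD /c0 opprK lnK ?posrE//.
  by rewrite le_eqVlt; apply/orP; left; apply/eqP; ring.
- clearbody K c0.
  have : e / 4 * K * K = (3 + 2 * c0) * K by rewrite Ke.
  nra.
Qed.

Variables (B : nat) (kap : R).
Hypotheses (B2 : (1 < B)%N) (kap1 : 1 <= kap).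

(** For k >= 1, the largest number m of sub-blocks for which exp(-kap)^m is still at least 1/k. *)
Definition block_count (k : nat) : nat := Num.truncn (ln k%:R / kap).

(* Block [k] occupies the bits [block_start k, block_start k.+1) and consists of
   [block_count k] sub-blocks of length [B ^ k]. *)
Definition block_start (k : nat) : nat := (\sum_(0 <= j < k) block_count j * B ^ j)%N.

Local Notation m := block_count.
Local Notation s := block_start.

Let kap0 : 0 < kap. Proof. by move: (kap1); lra. Qed.

Lemma block_startS k : s k.+1 = (s k + m k * B ^ k)%N.
Proof. by rewrite /s big_nat_recr. Qed.

Let ln_nat_ge0 k : 0 <= ln (k%:R : R).
Proof.
case: k => [|k]; first by rewrite ln0.
by rewrite ln_ge0// ler1n.
Qed.

Lemma block_count_itv k : (m k)%:R * kap <= ln (k%:R : R) < ((m k)%:R + 1) * kap.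
Proof.
have : 0 <= ln (k%:R : R) / kap by rewrite divr_ge0 ?ln_nat_ge0 ?ltW.
by move=> /truncn_itv; rewrite -natr1 ler_pdivlMr// ltr_pdivrMr.
Qed.

Lemma block_count_homo k : (m k <= m k.+1)%N.
Proof.
case: k => [|k]; first by rewrite /m ln0// mul0r truncn0.
apply: le_truncn; rewrite ler_pM2r ?invr_gt0//.
by rewrite ler_ln ?posrE ?ltr0n// ler_nat.
Qed.

Lemma block_count_le k : (m k <= k)%N.
Proof.
case: k => [|k]; first by rewrite /m ln0// mul0r truncn0.
rewrite -(ler_nat R); have /andP[h _] := block_count_itv k.+1.
have lk : ln (k.+1%:R : R) < k.+1%:R by rewrite ln_sublinear.
have : 0 <= (m k.+1)%:R :> R by [].
by move: (kap1) => k1 m0; nra.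
Qed.

(** A geometric sum, as [block_count] is monotone: for large B the whole past is short compared with
    block k. *)
Lemma block_start_le k : (s k * B.-1 <= m k * B ^ k)%N.
Proof.
elim: k => [|k IH]; first by rewrite /s big_geq.
rewrite block_startS mulnDl (leq_trans (leq_add IH (leqnn _)))//.
rewrite -mulnS prednK ?(ltnW B2)// -mulnA -expnSr.
by rewrite leq_mul2r block_count_homo orbT.
Qed.

Lemma block_start_ratio k : (s k * B <= s k.+1)%N.
Proof.
rewrite block_startS -{1}(prednK (ltnW B2)) mulnS leq_add2l.
exact: block_start_le.
Qed.

Lemma block_startS_le k : (s k.+1 * B.-1 <= m k * B ^ k * B)%N.
Proof.
rewrite block_startS mulnDl (leq_trans (leq_add (block_start_le k) (leqnn _)))//.
by rewrite -mulnS prednK// ltnW.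
Qed.

(** A crude bound that suffices because it enters through ln ln, where it gives ln k plus a
    constant. *)
Lemma block_start_expn k : (0 < k)%N -> (s k.+1 <= (4 * B) ^ k)%N.
Proof.
move=> k0; rewrite block_startS.
have h : (s k <= m k * B ^ k)%N.
  apply: leq_trans (block_start_le k); rewrite leq_pmulr//.
  by rewrite -ltnS prednK// ltnW.
rewrite (leq_trans (leq_add h (leqnn _)))// addnn -mul2n mulnA expnMn leq_mul2r.
apply/orP; right; rewrite (leq_trans (leq_mul (leqnn 2) (block_count_le k)))//.
rewrite -[4%N]/(2 * 2)%N expnMn leq_mul//; last exact/ltnW/ltn_expl.
by rewrite -{1}(expn1 2) leq_exp2l.
Qed.

Lemma block_start_large M : exists k1, forall k, (k1 <= k)%N -> (M <= s k)%N.
Proof.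
have [k1 Hk1] := @natr_large R (expR kap).
exists (maxn k1 M).+1 => -[//|k]; rewrite ltnS geq_max => /andP[/Hk1 kk Mk].
have k0 : 0 < k%:R :> R by apply: lt_le_trans kk; exact: expR_gt0.
have mk : (0 < m k)%N.
  have /andP[_ h2] := block_count_itv k.
  have h1 : kap <= ln k%:R by rewrite -ler_expR lnK ?posrE.
  have : 1 < (m k)%:R + 1 :> R.
    by rewrite -(ltr_pM2r kap0) mul1r (le_lt_trans h1 h2).
  by rewrite ltrDr ltr0n.
rewrite block_startS (leq_trans Mk)// (leq_trans _ (leq_addl _ _))//.
by rewrite (leq_trans _ (leq_pmull _ mk))// ltnW// ltn_expl.
Qed.

Variable p : R.
Hypotheses (p_gt0 : 0 < p) (p_lt1 : p < 1).
Local Notation var := (coin_var p).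

(** After squaring, three comparisons each lose a factor 1 - e / 4: ln ln n with [m k] times kap, n
    with the length of block k, and 2 kap with K^2. *)
Lemma lil_norm_lower (e K : R) : 0 < e -> e <= 1 -> 4 / e <= B%:R -> 0 <= K ->
  (1 - e / 4) * (2 * kap) <= K ^+ 2 ->
  exists k1, forall k, (k1 <= k)%N ->
    (1 - e / 2) * lil_norm p (s k.+1)%:R <=
    (m k)%:R * (K * Num.sqrt ((B ^ k)%:R * var)).
Proof.
move=> e0 e1 Be K0 Kkap.
have v0 : 0 < var := coin_var_gt0 p_gt0 p_lt1.
pose h := e / 4; have h0 : 0 < h by rewrite /h; lra.
have h14 : h <= 1 / 4 by rewrite /h; lra.
pose c1 := ln (ln (4 * B)%:R : R).
(* From here on h ln k absorbs kap, lost in rounding [block_count], and c1, lost in ln ln (4B)^k =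
   ln k + c1. *)
have [k1 Hk1] := @natr_large R (expR ((kap + c1) / h)).
have [k2 Hk2] := block_start_large (Num.truncn (expR 1 : R)).+1.
exists (maxn 1 (maxn k1 k2)) => k; rewrite !geq_max => /and3P[k0 /Hk1 hk /leqW/Hk2 sk].
have k0' : 0 < k%:R :> R by rewrite ltr0n.
set n := (s k.+1)%:R : R.
have n1 : expR 1 <= n.
  by apply/ltW/(lt_le_trans (truncnS_gt _)); rewrite ler_nat.
have n0 : 0 < n by apply: lt_le_trans n1; exact: expR_gt0.
have ln1 : 1 <= ln n by rewrite -ler_expR lnK ?posrE.
set l := ln (ln n).
have l0 : 0 <= l by rewrite ln_ge0.
have B40 : 1 < (4 * B)%:R :> R by rewrite ltr1n (leq_trans B2)// leq_pmull.
have lk : l <= ln k%:R + c1.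
  rewrite /c1 -lnM ?posrE ?ln_gt0// ler_ln ?posrE ?(lt_le_trans ltr01 ln1) ?mulr_gt0 ?ln_gt0//.
  rewrite mulr_natl -lnXn ?(lt_trans ltr01 B40)// ler_ln ?posrE ?exprn_gt0 ?(lt_trans ltr01 B40)//.
  by rewrite -natrX ler_nat block_start_expn.
have mk : (1 - h) * l <= (m k)%:R * kap.
  have /andP[_ mk] := block_count_itv k.
  have hl : kap + c1 <= h * ln k%:R.
    by rewrite mulrC -ler_pdivrMr// -ler_expR lnK ?posrE.
  have h1 : 0 <= 1 - h by lra.
  have c10 : 0 <= h * c1.
    rewrite mulr_ge0 ?(ltW h0)// ln_ge0// -ler_expR lnK ?posrE ?(lt_trans ltr01 B40)//.
    by rewrite (le_trans expR_1_le4)// ler_nat leq_pmulr// ltnW.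
  have := ler_wpM2l h1 lk; lra.
have B0 : 0 < B%:R :> R by rewrite ltr0n ltnW.
have nr : (1 - h) * n <= (m k)%:R * (B ^ k)%:R.
  have : n * (B%:R - 1) <= (m k)%:R * (B ^ k)%:R * B%:R.
    have -> : B%:R - 1 = B.-1%:R :> R.
      by rewrite -{1}(prednK (ltnW B2)) -natr1 addrK.
    by rewrite -!natrM ler_nat block_startS_le.
  have hB : 1 <= h * B%:R by rewrite mulrC -ler_pdivrMr// /h invf_div mul1r.
  move=> nB; rewrite -(ler_pM2r B0); apply: le_trans nB.
  have := ler_wpM2r (ltW n0) hB; lra.
have r0 : 0 <= (B ^ k)%:R * var by rewrite mulr_ge0 ?(ltW v0).
have e20 : 0 <= 1 - e / 2 by lra.
have h10 : 0 <= 1 - h by lra.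
have X0 : 0 <= 2 * var * n * l.
  by apply: mulr_ge0 => //; apply: mulr_ge0; lra.
rewrite /lil_norm -/l -ler_sqr ?nnegrE ?mulr_ge0 ?sqrtr_ge0// !exprMn !sqr_sqrtr//.
have := ler_pM (mulr_ge0 h10 (ltW n0)) (mulr_ge0 h10 l0) nr mk.
have mr0 : 0 <= (m k)%:R * (B ^ k)%:R * (m k)%:R :> R by rewrite !mulr_ge0.
have := ler_wpM2l mr0 Kkap.
have he : (1 - e / 2) ^+ 2 <= (1 - h) ^+ 3.
  have -> : e = 4 * h by rewrite /h; lra.
  move: (h) h0 h14 => u u0 u14; rewrite -subr_ge0.
  have -> : (1 - u) ^+ 3 - (1 - 4 * u / 2) ^+ 2 = u * (1 - u - u ^+ 2) by field.
  by rewrite mulr_ge0 ?(ltW u0)//; nra.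
have nl0 : 0 <= 2 * n * l by rewrite !mulr_ge0 ?(ltW n0).
have := ler_wpM2r nl0 he.
rewrite -/h; move: (m k)%:R (B ^ k)%:R => M r.
clearbody l n h => h1 h2 h3.
suff : (1 - e / 2) ^+ 2 * (2 * n * l) <= M ^+ 2 * (K ^+ 2 * r).
  move=> /(ler_wpM2r (ltW v0)); lra.
have h3' := ler_wpM2l (mulr_ge0 (ler0n _ 2) h10) h3.
lra.
Qed.

(** The starts grow by a factor of at least B >= 16 / e^2, whose square root is 4 / e; hence the
    past is negligible on the scale of the norm. *)
Lemma lil_norm_ratio (e : R) k : 0 < e -> 16 / e ^+ 2 <= B%:R ->
  expR 1 <= (s k)%:R :> R ->
  lil_norm p (s k)%:R <= e / 4 * lil_norm p (s k.+1)%:R.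
Proof.
move=> e0 eB s1.
have v0 : 0 < var := coin_var_gt0 p_gt0 p_lt1.
have e20 : 0 < e ^+ 2 by rewrite exprn_gt0.
have sn : (s k)%:R <= e ^+ 2 / 16 * (s k.+1)%:R :> R.
  have h : (s k)%:R * B%:R <= (s k.+1)%:R :> R by rewrite -natrM ler_nat block_start_ratio.
  have e160 : 0 <= e ^+ 2 / 16 by lra.
  apply: le_trans (ler_wpM2l e160 h).
  have := ler_wpM2l (mulr_ge0 e160 (ler0n R (s k))) eB.
  have -> : e ^+ 2 / 16 * (s k)%:R * (16 / e ^+ 2) = (s k)%:R by field; rewrite gt_eqF.
  lra.
have ss : (s k)%:R <= (s k.+1)%:R :> R by rewrite ler_nat block_startS leq_addr.
move: sn ss s1; set x := (s k)%:R; set y := (s k.+1)%:R => sn xy x1.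
have x0 : 0 < x by apply: lt_le_trans x1; exact: expR_gt0.
have y0 : 0 < y by lra.
have ln1 : 1 <= ln x by rewrite -ler_expR lnK ?posrE.
have lnxy : ln x <= ln y by rewrite ler_ln ?posrE.
have l0 : 0 <= ln (ln x) by rewrite ln_ge0.
have ll : ln (ln x) <= ln (ln y) by rewrite ler_ln ?posrE//; lra.
rewrite /lil_norm -ler_sqr ?nnegrE ?mulr_ge0 ?sqrtr_ge0//; last by lra.
have ly0 : 0 <= ln (ln y) by lra.
have x20 : 0 <= 2 * var * x * ln (ln x) by apply: mulr_ge0 => //; apply: mulr_ge0; lra.
have y20 : 0 <= 2 * var * y * ln (ln y) by apply: mulr_ge0 => //; apply: mulr_ge0; lra.
rewrite exprMn !sqr_sqrtr//.
have v20 : 0 <= 2 * var by lra.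
have := ler_wpM2l v20 (ler_pM (ltW x0) l0 sn ll).
lra.
Qed.

End lil_lower_schedule.

Section lil_lower.
Context d (T : measurableType d) (R : realType) (P : probability T R).

Lemma walk_reshape_ge (p : R) (y : R) m r (t : seq bool) : size t = (m * r)%N ->
  all (fun u => y <= coin_walk p u) (reshape (nseq m r) t) ->
  m%:R * y <= coin_walk p t.
Proof.
elim: m t => [|m IH] t /=; first by move=> /size0nil ->; rewrite coin_walk_nil mul0r.
rewrite mulSn => st /andP[yt /IH]; rewrite size_drop st addKn => /(_ erefl) h.
by rewrite -(cat_take_drop r t) coin_walk_cat -natr1 mulrDl mul1r addrC lerD.
Qed.

(** Comparison with the telescoping sum of ln(1 + 1/k) <= 1/k. *)
Lemma harmonic_large K (M : R) : (0 < K)%N ->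
  exists n, M <= \sum_(K <= k < K + n) (k%:R^-1 : R).
Proof.
move=> K0.
have H n : ln ((K + n)%:R : R) - ln K%:R <= \sum_(K <= k < K + n) (k%:R^-1 : R).
  elim: n => [|n IH]; first by rewrite addn0 big_geq// subrr.
  rewrite addnS big_nat_recr ?leq_addr//=.
  have Kn0 : 0 < (K + n)%:R :> R by rewrite ltr0n ltn_addr.
  have E : (K + n).+1%:R = (K + n)%:R * (1 + (K + n)%:R^-1) :> R.
    by rewrite -natr1 mulrDr mulr1 divff// gt_eqF.
  have V0 : 0 < (K + n)%:R^-1 :> R by rewrite invr_gt0.
  rewrite E lnM ?posrE ?addr_gt0//.
  have : ln (1 + (K + n)%:R^-1) <= (K + n)%:R^-1 :> R by rewrite le_ln1Dx//; lra.
  move: IH; lra.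
have [n Hn] := @natr_large R (expR (M + ln K%:R)).
exists n; apply: le_trans (H n); rewrite lerBrDr -ler_expR lnK.
  by rewrite (le_trans (Hn n (leqnn _)))// ler_nat leq_addl.
by rewrite posrE ltr0n ltn_addr.
Qed.

Lemma lil_lower (p : R) (b : nat -> T -> bool) (e : R) :
  0 < p -> p < 1 -> iid_bits P p b -> 0 < e -> e <= 1 ->
  \forall w \ae P, forall N, exists2 n, (N <= n)%N &
    (1 - e) * lil_norm p n%:R <= coin_walk p (bits b 0 n w).
Proof.
move=> p0 p1 iid_b e0 e1.
have [K [kap [K0 kap1 Kpdf Kkap]]] := gauss_pdf_rate e0 e1.
have [B1 HB1] := @natr_large R (4 / e).
have [B2 HB2] := @natr_large R (16 / e ^+ 2).
pose B := maxn 2 (maxn B1 B2).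
have Bgt1 : (1 < B)%N by rewrite leq_max.
have Be : 4 / e <= B%:R by apply: HB1; rewrite /B !leq_max leqnn !orbT.
have Be2 : 16 / e ^+ 2 <= B%:R by apply: HB2; rewrite /B !leq_max leqnn !orbT.
clearbody B.
pose m := @block_count R kap; pose s := @block_start R B kap.
have sS k : s k.+1 = (s k + m k * B ^ k)%N by exact: block_startS.
pose y k := K * Num.sqrt ((B ^ k)%:R * coin_var p).
pose A k (t : seq bool) :=
  all (fun u => y k <= coin_walk p u) (reshape (nseq (m k) (B ^ k)%N) t).
have [r0 Hr0] := coin_tail_ge p0 p1 K0.
have PA k : (r0 < k)%N -> k%:R^-1 <= coinP p (s k.+1 - s k) (A k).
  move=> rk; rewrite sS addKn coinP_all_blocks//.
  have rB : (r0 <= B ^ k)%N by rewrite ltnW// (ltn_trans rk)// ltn_expl.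
  have k0 : 0 < k%:R :> R by rewrite ltr0n (leq_ltn_trans _ rk).
  apply: (@le_trans _ _ (expR (- kap) ^+ m k)); last first.
    by rewrite lerXn2r ?nnegrE ?expR_ge0 ?coinP_ge0// (le_trans Kpdf)// Hr0.
  rewrite -expRM_natl -[leLHS]lnK ?posrE ?invr_gt0// ler_expR lnV ?posrE//.
  by rewrite mulrN lerN2; have /andP[] := block_count_itv kap1 k.
have iE : \forall w \ae P, forall K, exists2 k, (K <= k)%N &
    A k (bits b (s k) (s k.+1 - s k) w).
  apply: (@borel_cantelli_blocks _ _ _ _ _ p0 p1 _ iid_b s A r0.+1).
    by move=> k; rewrite sS leq_addr.
  move=> k0 M rk0; have [n Hn] := harmonic_large M (leq_trans (ltn0Sn r0) rk0).
  exists n; apply: (le_trans Hn); rewrite big_nat_cond [leRHS]big_nat_cond.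
  apply: ler_sum => k /andP[/andP[k0k _] _]; apply: PA.
  exact: leq_trans k0k.
have [k1 Hk1] := lil_norm_lower Bgt1 kap1 p0 p1 e0 e1 Be K0 Kkap.
have [k2 Hk2] := block_start_large Bgt1 kap1 (Num.truncn (expR 1 : R)).+1.
(* The walk before block k is at least -2 times the norm at [s k], hence at least -e/2 times the
   norm at [s k.+1]. Block k contributes 1 - e/2 times the latter. *)
have := lil_upper_opp p0 p1 iid_b ltr01; apply: filterS2 iE => w Aw [N1 HN1] N.
have [k3 Hk3] := block_start_large Bgt1 kap1 (maxn N N1).
have [k + Ak] := Aw (maxn k1 (maxn k2 k3)).
rewrite !geq_max => /and3P[/Hk1 hk /Hk2 sk /Hk3]; rewrite geq_max => /andP[Nk N1k].
have ss : (s k <= s k.+1)%N by rewrite sS leq_addr.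
exists (s k.+1); first exact: leq_trans ss.
rewrite -(subnKC ss) bits_cat coin_walk_cat add0n.
have h1 : (m k)%:R * y k <= coin_walk p (bits b (s k) (s k.+1 - s k) w).
  by apply: walk_reshape_ge Ak; rewrite size_bits sS addKn.
have h2 := HN1 _ N1k.
have s1 : expR 1 <= (s k)%:R :> R.
  by apply/ltW/(lt_le_trans (truncnS_gt _)); rewrite ler_nat.
have h3 := lil_norm_ratio Bgt1 kap1 p0 p1 e0 Be2 s1.
move: h1 h2 h3 hk; rewrite -/s -/m -/(y k) subnKC//.
move: (coin_walk _ _) (coin_walk _ _) => X Y.
by move: (lil_norm _ _) (lil_norm _ _) ((m k)%:R * y k) => U V W; lra.
Qed.

End lil_lower.

(** * Consequences for bounded perturbations of the walk *)

Section coin_clt_shift.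
Context {R : realType}.
Variable p : R.
Hypotheses (p_gt0 : 0 < p) (p_lt1 : p < 1).

Local Notation coinP := (coinP p).
Local Notation walk := (coin_walk p).
Local Notation var := (coin_var p).

(** The shift c and the passage from n to n + 1 in the normalisation move the threshold x by at most
    h, and Phi is 1-Lipschitz. This is the form left after the first bit is split off. *)
Lemma coin_clt_shift (x c e : R) : 0 < e -> exists N, forall n, (N <= n)%N ->
  `|coinP n (fun s => walk s + c <= x * Num.sqrt (n.+1%:R * var)) - gauss_cdf x| <= e.
Proof.
move=> e0; pose h := e / 2; have h0 : 0 < h by rewrite /h; lra.
have [N1 H1] := coin_clt p_gt0 p_lt1 (x + h) h0.
have [N2 H2] := coin_clt p_gt0 p_lt1 (x - h) h0.
have [N3 H3] := sqrt_var_large p_gt0 p_lt1 ((`|x| + `|c|) / h).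
exists (maxn N1 (maxn N2 N3)) => n; rewrite !geq_max => /and3P[/H1 + /H2 + /H3].
have := gauss_cdf_lip x (x + h); have := gauss_cdf_lip x (x - h).
rewrite addrAC subrr add0r normrN (gtr0_norm h0) addrAC subrr add0r (gtr0_norm h0).
set u := Num.sqrt (n%:R * var); set v := Num.sqrt (n.+1%:R * var).
rewrite (ler_pdivrMr _ _ h0) => L2 L1 C1 C2 hu.
have v0 := coin_var_gt0 p_gt0 p_lt1; have v1 := coin_var_le1 p.
have nv0 k : 0 <= k%:R * var := mulr_ge0 (ler0n _ k) (ltW v0).
have u0 : 0 <= u := sqrtr_ge0 _.
have uv : u <= v by rewrite /v ler_wsqrtr// ler_pM2r// ler_nat.
have vu : v <= u + 1.
  rewrite -ler_sqr ?nnegrE ?sqrtr_ge0 ?addr_ge0//.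
  have -> : v ^+ 2 = n%:R * var + var.
    by rewrite (sqr_sqrtr (nv0 _)) -natr1; ring.
  have <- : u ^+ 2 = n%:R * var := sqr_sqrtr (nv0 _).
  by rewrite sqrrD; lra.
have xvu : `|x * (v - u) - c| <= u * h.
  apply: (le_trans _ hu); rewrite (le_trans (ler_normB _ _))// lerD2r normrM ler_piMr//.
  by rewrite ler_norml; lra.
have F1 : coinP n (fun s => walk s + c <= x * v) <= coinP n (fun s => walk s <= (x + h) * u).
  by apply: coinP_le => // s _; move: xvu; rewrite ler_norml => /andP[_ h1] h2; lra.
have F2 : coinP n (fun s => walk s <= (x - h) * u) <= coinP n (fun s => walk s + c <= x * v).
  by apply: coinP_le => // s _; move: xvu; rewrite ler_norml => /andP[h1 _] h2; lra.
have he : e = 2 * h by rewrite /h; lra.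
rewrite he; move: F1 F2 C1 C2 L1 L2.
move: (coinP n _) (coinP n _) (coinP n _) (gauss_cdf _) (gauss_cdf _) (gauss_cdf _).
by clear => A B C D E F; rewrite !ler_norml; lra.
Qed.

(** The complementary event is a strict inequality; it lies between the non-strict ones with shifts
    c + 1 and c. *)
Lemma coin_clt_shift_opp (x c e : R) : 0 < e -> exists N, forall n, (N <= n)%N ->
  `|coinP n (fun s => - (walk s + c) <= x * Num.sqrt (n.+1%:R * var)) - gauss_cdf x| <= e.
Proof.
move=> e0.
have [N1 H1] := coin_clt_shift (- x) c e0.
have [N2 H2] := coin_clt_shift (- x) (c + 1) e0.
exists (maxn N1 N2) => n; rewrite geq_max => /andP[/H1 + /H2].
rewrite !gauss_cdfN; set v := Num.sqrt _; move=> C1 C2.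
have := coinPC p_gt0 p_lt1 n (fun s => - (walk s + c) <= x * v).
set G := coinP n _.
have F1 : G <= coinP n (fun s => walk s + c <= - x * v).
  by apply: coinP_le => // s _ /=; rewrite -ltNge; lra.
have F2 : coinP n (fun s => walk s + (c + 1) <= - x * v) <= G.
  by apply: coinP_le => // s _ /=; rewrite -ltNge; lra.
move: F1 F2 C1 C2; rewrite -/G; move: G.
move: (coinP n _) (coinP n _) (coinP n _) (gauss_cdf _).
by clear => A B C D E; rewrite !ler_norml; lra.
Qed.

End coin_clt_shift.

(** * From eventual and frequent bounds to the limit superior *)

Section lil_limsup.
Context {R : realType}.

Lemma limn_esup_eq1 (u : nat -> R) :
  (forall e, 0 < e -> exists N, forall n, (N <= n)%N -> u n <= 1 + e) ->
  (forall e, 0 < e -> e <= 1 -> forall N, exists2 n, (N <= n)%N & 1 - e <= u n) ->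
  limn_esup (fun n => (u n)%:E) = 1%E.
Proof.
move=> uub ulb; apply/eqP; rewrite eq_le; apply/andP; split.
  apply/lee_addgt0Pr => e /uub[N HN]; apply: ereal_inf_le.
  exists (ereal_sup ((fun n => (u n)%:E) @` [set n | (N <= n)%N])).
    by exists [set n | (N <= n)%N] => //; exists N.
  by apply: ge_ereal_sup => _ [n /= /HN un <-]; rewrite -EFinD lee_fin.
apply: le_ereal_inf_tmp => _ [V [N _ NV] <-].
apply/lee_addgt0Pr => e e0; pose e' := Num.min e 1.
have e'0 : 0 < e' by rewrite lt_min e0 ltr01.
have [|n Nn un] := ulb _ e'0 _ N; first by rewrite ge_min lexx orbT.
apply: (@le_trans _ _ ((u n)%:E + e%:E)%E).
  rewrite -EFinD lee_fin; have : e' <= e by rewrite ge_min lexx.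
  lra.
by rewrite leeD2r//; apply: ereal_sup_ubound; exists n => //; exact: NV.
Qed.

Variable p : R.
Hypotheses (p_gt0 : 0 < p) (p_lt1 : p < 1).

Lemma lil_norm_large (M : R) : exists N, forall n, (N <= n)%N -> M <= lil_norm p n%:R.
Proof.
have v0 : 0 < coin_var p := coin_var_gt0 p_gt0 p_lt1.
have [N1 H1] := sqrt_var_large p_gt0 p_lt1 M.
have [N2 H2] := @natr_large R (expR (expR 1)).
exists (maxn N1 N2) => n; rewrite geq_max => /andP[/H1 + /H2 ne].
move=> /le_trans; apply; rewrite /lil_norm ler_wsqrtr//.
have n0 : 0 < n%:R :> R := lt_le_trans (expR_gt0 _) ne.
have l1 : expR 1 <= ln n%:R :> R by rewrite -ler_expR lnK ?posrE.
have l2 : 1 <= ln (ln n%:R) :> R.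
  by rewrite -ler_expR lnK ?posrE// (lt_le_trans (expR_gt0 _) l1).
have nv : 0 <= n%:R * coin_var p := mulr_ge0 (ler0n _ n) (ltW v0).
by have := ler_wpM2l nv l2; lra.
Qed.

End lil_limsup.

Section lil.
Context d (T : measurableType d) (R : realType) (P : probability T R).

Lemma inv_natr_small (e : R) : 0 < e -> exists j : nat, j.+1%:R^-1 <= e.
Proof.
move=> e0; have [j Hj] := @natr_large R e^-1; exists j.
rewrite -[leRHS]invrK lef_pV2 ?posrE ?invr_gt0// (le_trans (Hj j (leqnn _)))//.
by rewrite ler_nat.
Qed.

(** [Y] is quantified inside the almost sure statement, so that one null set serves sequences chosen
    according to the first sign. *)
Lemma lil_limsup (p : R) (b : nat -> T -> bool) :
  0 < p -> p < 1 -> iid_bits P p b ->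
  \forall w \ae P, forall Y : nat -> R,
    (forall n, (0 < n)%N -> `|Y n - coin_walk p (bits b 0 n w)| <= 2) ->
    limn_esup (fun n => (Y n / lil_norm p n%:R)%:E) = 1%E.
Proof.
move=> p0 p1 iid_b.
(* Only the values e = 1/(j + 1) are used, so that the exceptional sets have a null union. *)
have ej0 (j : nat) : 0 < j.+1%:R^-1 :> R by rewrite invr_gt0.
have ej1 (j : nat) : j.+1%:R^-1 <= 1 :> R by rewrite invf_le1// ler1n.
have up := ae_foralln (fun j => lil_upper p0 p1 iid_b (ej0 j)).
have lo := ae_foralln (fun j => lil_lower p0 p1 iid_b (ej0 j) (ej1 j)).
apply: filterS2 up lo => w up lo Y YT.
have large e : 0 < e -> exists N, forall n, (N <= n)%N ->
    [/\ (0 < n)%N, 0 < lil_norm p n%:R & 2 <= e / 2 * lil_norm p n%:R].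
  move=> e0; have [N HN] := lil_norm_large p0 p1 (4 / e).
  exists N.+1 => n Nn; have := HN n (ltnW Nn).
  have : 0 < 4 / e by rewrite divr_gt0.
  move=> h1 h2; split; [exact: leq_ltn_trans Nn|lra|].
  by move: h2; rewrite ler_pdivrMr//; lra.
apply: limn_esup_eq1 => [e e0|e e0 e1 N].
- have e20 : 0 < e / 2 by lra.
  have [N1 H1] := large e e0; have [j ej] := inv_natr_small e20.
  have [N2 H2] := up j; exists (maxn N1 N2) => n.
  rewrite geq_max => /andP[/H1[n0 a0 a2] /H2 Tn].
  rewrite ler_pdivrMr//; have := YT n n0; rewrite ler_norml => /andP[_ Yn].
  move: (j.+1%:R^-1) ej Tn => i ej Tn; have := ler_wpM2r (ltW a0) ej; lra.
- have e20 : 0 < e / 2 by lra.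
  have [N1 H1] := large e e0; have [j ej] := inv_natr_small e20.
  have [n + Tn] := lo j (maxn N N1); rewrite geq_max => /andP[Nn /H1[n0 a0 a2]].
  exists n => //; rewrite ler_pdivlMr//; have := YT n n0; rewrite ler_norml => /andP[Yn _].
  move: (j.+1%:R^-1) ej Tn => i ej Tn; have := ler_wpM2r (ltW a0) ej; lra.
Qed.

(** From ln ln x <= ln x <= 2 sqrt x, the squared norm is O(x^(3/2)). This is how (b) follows from
    the iterated logarithm bounds. *)
Lemma lil_norm_over_n (p e : R) : 0 < p -> p < 1 -> 0 < e ->
  exists N, forall n, (N <= n)%N -> lil_norm p n%:R <= e * n%:R.
Proof.
move=> p0 p1 e0; have v0 := coin_var_gt0 p0 p1; have v1 := coin_var_le1 p.
have [N1 H1] := @natr_large R ((4 / e ^+ 2) ^+ 2).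
have [N2 H2] := @natr_large R (expR 1).
exists (maxn N1 N2) => n; rewrite geq_max => /andP[/H1 + /H2].
set x := n%:R => nx ne.
have x0 : 0 < x := lt_le_trans (expR_gt0 _) ne.
have lnx1 : 1 <= ln x by rewrite -ler_expR lnK ?posrE.
have lnx0 : 0 < ln x by lra.
have l0 : 0 <= ln (ln x) by rewrite ln_ge0.
have ll : ln (ln x) < ln x := ln_sublinear lnx0.
pose y := Num.sqrt x; have y0 : 0 < y by rewrite sqrtr_gt0.
have y2 : y ^+ 2 = x by rewrite sqr_sqrtr// ltW.
have lnxy : ln x <= 2 * y.
  by rewrite -y2 lnXn// -mulr_natl; have := ln_sublinear y0; lra.
have ye : 4 <= e ^+ 2 * y.
  rewrite mulrC -ler_pdivrMr ?exprn_gt0// -ler_sqr ?nnegrE ?(ltW y0) ?y2//.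
  by rewrite divr_ge0 ?sqr_ge0.
rewrite -ler_sqr ?nnegrE ?mulr_ge0 ?sqrtr_ge0 ?(ltW e0) ?(ltW x0)//.
have vx : 0 <= 2 * coin_var p * x.
  by apply: mulr_ge0; [apply: mulr_ge0; lra|lra].
rewrite (sqr_sqrtr (mulr_ge0 vx l0)).
have h1 : ln (ln x) <= 2 * y by lra.
have h2 := ler_wpM2l vx h1.
have xy0 : 0 <= x * y by rewrite mulr_ge0 ?ltW.
have h3 := ler_wpM2r xy0 v1.
have h4 : x * y * 4 <= x * y * (e ^+ 2 * y) by rewrite ler_wpM2l.
have h5 : x * y * (e ^+ 2 * y) = (e * x) ^+ 2.
  by rewrite exprMn [x in RHS]lock -y2 -lock expr2; ring.
by rewrite -h5; lra.
Qed.

End lil.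

(** * The elephant walk as a function of independent bits *)

Lemma one_neqN1 (R : realType) : (1 : R) <> -1.
Proof. by move=> h; lra. Qed.

Section walk_bits.
Context d (T : measurableType d) (R : realType) (P : probability T R).
Variable p : R.

Definition walk_bits (X eps : nat -> {RV P >-> R}) (i : nat) (w : T) : bool :=
  if i is i'.+1 then eps i'.+2 w == 1 else X 1%N w == 1.

(** The complement of 1 rather than the point -1, so that events on bits are preimages everywhere
    and not only almost surely. *)
Definition is_one (c : bool) : set R := if c then [set 1] else ~` [set 1].

Lemma measurable_is_one c : measurable (is_one c).
Proof. by case: c; [|apply: measurableC]; exact: measurable_set1. Qed.

Lemma preimage_is_one (Y : {RV P >-> R}) c :
  Y @^-1` is_one c = [set w | (Y w == 1) = c].
Proof. by apply/seteqP; split => w; case: c => /=; case: eqP. Qed.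

Lemma measurable_RV_preimage (Y : {RV P >-> R}) (B : set R) :
  measurable B -> measurable (Y @^-1` B).
Proof.
by move=> mB; rewrite -[X in measurable X]setTI; exact: measurable_funP.
Qed.

Lemma prob_is_one (Y : {RV P >-> R}) c : sign_law p Y ->
  P (Y @^-1` is_one c) = (if c then p else 1 - p)%:E.
Proof.
case: c => -[Y1 _] //; rewrite /is_one.
rewrite -preimage_setC probability_setC ?Y1//.

Qed.

Lemma sign_law_ae (Y : {RV P >-> R}) : sign_law p Y ->
  \forall w \ae P, Y w = 1 \/ Y w = -1.
Proof.
move=> [Y1 YN1].
have m1 : measurable (Y @^-1` [set 1]).
  by apply: measurable_RV_preimage; exact: measurable_set1.
have mN1 : measurable (Y @^-1` [set -1]).
  by apply: measurable_RV_preimage; exact: measurable_set1.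
exists (~` (Y @^-1` [set 1] `|` Y @^-1` [set -1])); split.
- by apply: measurableC; exact: measurableU.
- rewrite probability_setC; last exact: measurableU.
  rewrite (_ : P (_ `|` _) = 1%E) ?subee//.
  transitivity (P (Y @^-1` [set 1%R]) + P (Y @^-1` [set (-1)%R]))%E.
    apply: measureU => //; apply/seteqP; split => w //= -[->].
    exact: one_neqN1.
  by rewrite Y1 YN1 -EFinD subrKC.
- by move=> w /=; apply: contra_not.
Qed.

Lemma iid_walk_bits (X eps : nat -> {RV P >-> R}) :
  sign_law p (X 1%N) -> (forall n, (2 <= n)%N -> sign_law p (eps n)) ->
  mutually_independent [set n | (2 <= n)%N] eps ->
  independent_of_family (X 1%N) [set n | (2 <= n)%N] eps ->
  iid_bits P p (walk_bits X eps).
Proof.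
move=> lawX laweps indeps indX; split=> [[|i]|[|c s]].
- rewrite (_ : mkset _ = X 1%N @^-1` [set 1]).
    by apply: measurable_RV_preimage; exact: measurable_set1.
  by apply/seteqP; split => w /= /eqP.
- rewrite (_ : mkset _ = eps i.+2 @^-1` [set 1]).
    by apply: measurable_RV_preimage; exact: measurable_set1.
  by apply/seteqP; split => w /= /eqP.
- by rewrite big_nil (_ : mkset _ = setT) ?probability_setT//; apply/seteqP.
(* Letter i of s, counted from 0, constrains [eps i.+2]. *)
pose J : {fset nat} := [fset i in iota 2 (size s)]%fset.
have JE i : (i \in J) = (2 <= i < 2 + size s)%N by rewrite in_fset/= mem_iota.
pose B i := is_one (nth true s (i - 2)).
have mB i : measurable (B i) by exact: measurable_is_one.
have J2 : [set` J] `<=` [set n | (2 <= n)%N].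
  by move=> i /=; rewrite JE => /andP[].
have -> : [set w | bits (walk_bits X eps) 0 (size (c :: s)) w = c :: s] =
   X 1%N @^-1` is_one c `&` \bigcap_(i in [set` J]) (eps i @^-1` B i).
  apply/seteqP; split => w /=.
    rewrite bitsS => -[Xc bs]; split.
      by have : (X 1%N @^-1` is_one c) w by rewrite preimage_is_one.
    move=> i; rewrite /= JE => /andP[i2 is2].
    have : (eps i @^-1` B i) w; last by [].
    rewrite preimage_is_one /= -bs (nth_map 0%N) ?size_iota; last by rewrite ltn_subLR.
    rewrite nth_iota ?ltn_subLR// addnC addn1 -addn1 /walk_bits.
    by rewrite addn1 -addn2 subnK.
  move=> [Xc epsB]; rewrite bitsS; congr (_ :: _).
    by have : (X 1%N @^-1` is_one c) w by []; rewrite preimage_is_one.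
  apply: (@eq_from_nth _ true); rewrite size_bits// => i si.
  have iJ : [set` J] i.+2 by rewrite /= JE add2n !ltnS.
  have h := epsB _ iJ.
  have : (eps i.+2 @^-1` B i.+2) w by [].
  rewrite preimage_is_one /= subn2 /= => <-.
  by rewrite (nth_map 0%N) ?size_iota// nth_iota// add1n.
rewrite indX; last 2 first.
- exists (is_one c) => //; last by rewrite setTI.
  exact: measurable_is_one.
- set C := \bigcup_(i in _) _.
  apply: (@fin_bigcap_measurable _ (g_sigma_algebraType C)) => // i iJ.
  apply: sub_sigma_algebra; exists i; first exact: J2.
  by exists (B i) => //; rewrite setTI.
rewrite prob_is_one// indeps// big_cons EFinM; congr (_ * _)%E.
rewrite (perm_big (iota 2 (size s))); last first.
  apply: uniq_perm; rewrite ?fset_uniq ?iota_uniq// => i.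
  by rewrite JE mem_iota.
rewrite -prodEFin.
transitivity (\prod_(i <- iota 2 (size s)) (if nth true s (i - 2) then p else 1 - p)%:E)%E.
  rewrite big_seq [RHS]big_seq; apply: eq_bigr => i; rewrite mem_iota => /andP[i2 _].
  by rewrite prob_is_one//; exact: laweps.
rewrite (iotaDl 2 0) big_map (big_nth true) -/(index_iota 0 (size s)) /index_iota subn0.
by apply: eq_bigr => i _; rewrite addKn.
Qed.

End walk_bits.

(** * The centered position in terms of the bits *)

Section centered_position.
Context d (T : measurableType d) (R : realType) (P : probability T R).

Lemma prob_le_ae (A B : set T) : measurable A -> measurable B ->
  (\forall w \ae P, A w -> B w) -> (P A <= P B)%E.
Proof.
move=> mA mB [N [mN PN0 AB]].
apply: (@le_trans _ _ (P (B `|` N))).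
  apply: le_measure; rewrite ?inE//; first exact: measurableU.
  move=> w Aw; have [Bw|nBw] := pselect (B w); [by left|right].
  by apply: AB => /= h; apply/nBw/h.
have -> : P B = (P B + P N)%E by rewrite PN0 adde0.
exact: measureU2.
Qed.

Lemma prob_eq_ae (A B : set T) : measurable A -> measurable B ->
  (\forall w \ae P, A w <-> B w) -> P A = P B.
Proof.
move=> mA mB AB; apply/le_anti/andP.
by split; apply: prob_le_ae => //; apply: filterS AB => w [].
Qed.

(** Factoring out X_1 leaves a first step 1 - (2p - 1), whichever sign X_1 has. If X_1 = -1 the bit
    walk starts with -1 - (2p - 1) instead; the 2 corrects this. *)
Lemma centered_position_bits (p : R) (X eps : nat -> {RV P >-> R}) (w : T) n :
  (X 1%N w = 1 \/ X 1%N w = -1) ->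
  (forall k, eps k.+2 w = 1 \/ eps k.+2 w = -1) ->
  (forall k, X k.+2 w = eps k.+2 w * X 1%N w) ->
  centered_position p (fun n => X n) n.+1 w =
    if walk_bits X eps 0 w then coin_walk p (bits (walk_bits X eps) 0 n.+1 w)
    else - (coin_walk p (bits (walk_bits X eps) 0 n.+1 w) + 2).
Proof.
move=> X1 epsw XE; have N11 : -1 == 1 :> R = false.
  by apply/eqP => /esym; exact: one_neqN1.
elim: n => [|n IH].
  rewrite /centered_position /position big_nat1 bitsS/= coin_walk_cons coin_walk_nil.
  rewrite /= /coin_step; case: X1 => ->; rewrite ?eqxx ?N11; lra.
have -> : centered_position p (fun n => X n) n.+2 w =
    centered_position p (fun n => X n) n.+1 w + (eps n.+2 w - (2 * p - 1)) * X 1%N w.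
  rewrite /centered_position /position big_nat_recr//= XE -[n.+2%:R]natr1.
  by ring.
have -> : coin_walk p (bits (walk_bits X eps) 0 n.+2 w) =
    coin_walk p (bits (walk_bits X eps) 0 n.+1 w) + coin_step p (eps n.+2 w == 1).
  rewrite -[n.+2]addn1 bits_cat coin_walk_cat; congr (_ + _).
  by rewrite addn1 bitsS coin_walk_cons coin_walk_nil addr0.
rewrite IH /=; move: (coin_walk _ _) => S.
by rewrite /coin_step; case: (epsw n) => ->; case: X1 => ->; rewrite ?eqxx ?N11; lra.
Qed.

Lemma measurable_centered_position (p : R) (X : nat -> {RV P >-> R}) n :
  measurable_fun setT (centered_position p (fun n => X n) n).
Proof.
apply: measurable_funB; last by apply: measurable_funM.
exact: measurable_sum.
Qed.

End centered_position.

Unset Implicit Arguments.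
Set Strict Implicit.
Set Printing Implicit Defensive.

(* At n = 1 the normalisation in (c) involves ln (ln 1) = ln 0 = 0 and at
   n = 2 the square root of a negative number, which is 0; division by 0 gives
   0, so finitely many finite terms are affected and limsup and liminf are
   not. *)
Theorem theorem5p2 (d : measure_display) (T : measurableType d) (R : realType)
    (P : probability T R) (p : R) (X : nat -> {RV P >-> R})
    (p_gt0 : 0 < p) (p_lt1 : p < 1)
    (walkX : first_step_elephant_walk p X) :
  [/\ cvg_in_distribution P
        (fun n w => centered_position p X n w /
                    Num.sqrt (4 * n%:R * p * (1 - p)))
        (normal_prob 0 1),
      \forall w \ae P,
        centered_position p X n w / n%:R @[n --> \oo] --> (0 : R) &
      \forall w \ae P,
        limn_esup (fun n => (centered_position p X n w /
          Num.sqrt (8 * n%:R * p * (1 - p) * ln (ln n%:R)))%:E) = 1%E /\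
        limn_einf (fun n => (centered_position p X n w /
          Num.sqrt (8 * n%:R * p * (1 - p) * ln (ln n%:R)))%:E) = (-1)%E].
Proof.
move: walkX => [lawX [eps [laweps indeps indX XE]]].
have iid_b := iid_walk_bits lawX laweps indeps indX.
set b := walk_bits X eps in iid_b.
have signs : \forall w \ae P, (X 1%N w = 1 \/ X 1%N w = -1) /\
    forall k, eps k.+2 w = 1 \/ eps k.+2 w = -1.
  apply: filterS2 (sign_law_ae lawX) (ae_foralln (fun k => sign_law_ae (laweps k.+2 isT))).
  by [].
have center : \forall w \ae P, forall n, centered_position p (fun n => X n) n.+1 w =
    if b 0 w then coin_walk p (bits b 0 n.+1 w)
    else - (coin_walk p (bits b 0 n.+1 w) + 2).
  apply: filterS signs => w [X1w epsw] n.
  by apply: centered_position_bits => // k; rewrite XE.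
have q_gt0 : 0 < 1 - p by lra.
have q_lt1 : 1 - p < 1 by lra.
have normE n : Num.sqrt (8 * n%:R * p * (1 - p) * ln (ln n%:R)) = lil_norm p n%:R.
  by rewrite /lil_norm /coin_var; congr (Num.sqrt _); ring.
have varE n : Num.sqrt (4 * n%:R * p * (1 - p)) = Num.sqrt (n%:R * coin_var p).
  by rewrite /coin_var; congr (Num.sqrt _); ring.
split.
- have mY n : measurable_fun setT (fun w => centered_position p X n w /
      Num.sqrt (4 * n%:R * p * (1 - p))).
    by apply: measurable_funM => //; exact: measurable_centered_position.
  split=> [//|x _].
  have mYx n : measurable ((fun w => centered_position p X n w /
      Num.sqrt (4 * n%:R * p * (1 - p))) @^-1` `]-oo, x]).
    rewrite -[X in measurable X]setTI.
    exact: (mY n measurableT _ (measurable_itv _)).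
  rewrite [X in _ --> X](_ : _ = (gauss_cdf x)%:E); last by rewrite EFin_gauss_cdf.
  pose v n : R := Num.sqrt (n%:R * coin_var p).
  pose G n (s : seq bool) := if head true s then coin_walk p s <= x * v n
    else - (coin_walk p s + 2) <= x * v n.
  have v_gt0 n : 0 < v n.+1.
    by rewrite sqrtr_gt0 mulr_gt0// coin_var_gt0.
  have PG n : P ((fun w => centered_position p X n.+1 w /
      Num.sqrt (4 * n.+1%:R * p * (1 - p))) @^-1` `]-oo, x]) =
      (coinP p n.+1 (G n.+1))%:E.
    rewrite -(prob_bits p_gt0 p_lt1 iid_b 0); apply: prob_eq_ae.
    - exact: mYx.
    - exact: (measurable_bits iid_b _ _ (G n.+1)).
    apply: filterS center => w cw /=.
    rewrite in_itv/= varE ler_pdivrMr ?v_gt0// cw /G.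
    by rewrite (_ : head true _ = b 0 w)//; case: (b 0 w).
  (* Splitting on the first bit leaves the same shift in both cases, as [coin_step p false] + 2 = 2
     (1 - p). *)
  have GE n : coinP p n.+1 (G n.+1) =
      p * coinP p n (fun s => coin_walk p s + 2 * (1 - p) <= x * v n.+1) +
      (1 - p) * coinP p n (fun s => - (coin_walk p s + 2 * (1 - p)) <= x * v n.+1).
    rewrite /coinP /=; congr (_ * _ + _ * _); apply: eq_coinE => // s _.
      by rewrite /G /= coin_walk_cons addrC.
    rewrite /G [head _ _]/= coin_walk_cons.
    by rewrite (_ : coin_step p false + _ + 2 = coin_walk p s + 2 * (1 - p))// /coin_step; ring.
  apply: cvg_EFin; first by apply: nearW => n; apply: fin_num_measure; exact: mYx.
  apply/cvgrPdist_le => e e0.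
  have [N1 H1] := coin_clt_shift p_gt0 p_lt1 x (2 * (1 - p)) e0.
  have [N2 H2] := coin_clt_shift_opp p_gt0 p_lt1 x (2 * (1 - p)) e0.
  exists (maxn N1 N2).+1 => // -[//|n] /=.
  rewrite ltnS geq_max => /andP[/H1 C1 /H2 C2]; rewrite PG /= GE.
  move: C1 C2; rewrite -/(v n.+1).
  move: (coinP _ _ _) (coinP _ _ _) (gauss_cdf x) => A B C.
  rewrite !ler_norml => /andP[A1 A2] /andP[B1 B2].
  have := ler_wpM2l (ltW p_gt0) A1; have := ler_wpM2l (ltW p_gt0) A2.
  have := ler_wpM2l (ltW q_gt0) B1; have := ler_wpM2l (ltW q_gt0) B2.
  by move: p_gt0 q_gt0 e0 => ? ? ?; lra.
(* The walk is at most twice the norm in absolute value, hence at most n e / 2; the additive 2 is at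
   most n e / 2 once n >= 4 / e. *)
- apply: filterS2 center (filterI (lil_upper p_gt0 p_lt1 iid_b ltr01)
    (lil_upper_opp p_gt0 p_lt1 iid_b ltr01)) => w cw [[N1 H1] [N2 H2]].
  apply/cvgrPdist_le => e e0.
  have e40 : 0 < e / 4 by lra.
  have [N3 H3] := lil_norm_over_n p_gt0 p_lt1 e40.
  have [N4 H4] := @natr_large R (4 / e).
  exists (maxn (maxn N1 N2) (maxn N3 N4)).+1 => // -[//|n] /=.
  rewrite ltnS !geq_max => /andP[/andP[/leqW/H1 T1 /leqW/H2 T2] /andP[/leqW/H3 a3 /leqW/H4 n4]].
  have n0 : 0 < n.+1%:R :> R by [].
  rewrite sub0r normrN normrM normfV (gtr0_norm n0) ler_pdivrMr// cw.
  move: T1 T2 a3 n4 n0; rewrite ler_pdivrMr//.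
  move: (n.+1%:R) (lil_norm _ _) (coin_walk _ _) => C B A.
  by case: (b 0 w); rewrite ler_norml; lra.
- have lim1 := lil_limsup p_gt0 p_lt1 iid_b.
  have lim2 := lil_limsup q_gt0 q_lt1 (iid_bits_flip iid_b).
  apply: filterS3 center lim1 lim2 => w cw lim1 lim2.
  pose Y n := centered_position p X n w.
  have T2 n : coin_walk (1 - p) (bits (fun i w => ~~ b i w) 0 n w) =
      - coin_walk p (bits b 0 n w) by rewrite bits_flip coin_walk_flip.
  have lim2' Z : (forall n, (0 < n)%N -> `|Z n + coin_walk p (bits b 0 n w)| <= 2) ->
      limn_esup (fun n => (Z n / lil_norm p n%:R)%:E) = 1%E.
    move=> ZT; rewrite -(lim2 Z).
      by congr limn_esup; apply/funext => n; rewrite lil_norm_flip.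
    by move=> n n0; rewrite T2 opprK ZT.
  have -> : (fun n => (centered_position p X n w /
      Num.sqrt (8 * n%:R * p * (1 - p) * ln (ln n%:R)))%:E) =
      (fun n => (Y n / lil_norm p n%:R)%:E).
    by apply/funext => n; rewrite normE.
  (* According to the first bit, [Y] stays within 2 of the walk or of its negative, and -[Y] of the
     other one. Both have limit superior 1. *)
  have sup_Y : limn_esup (fun n => (Y n / lil_norm p n%:R)%:E) = 1%E.
    have [b0|b0] := boolP (b 0 w); [apply: lim1|apply: lim2'] => -[//|n] _;
      rewrite /Y cw ?b0 ?(negbTE b0).
      by rewrite subrr normr0.
    by rewrite opprD addrAC addNr add0r normrN ger0_norm.
  have sup_NY : limn_esup (fun n => (- Y n / lil_norm p n%:R)%:E) = 1%E.
    have [b0|b0] := boolP (b 0 w); [apply: lim2'|apply: lim1] => -[//|n] _;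
      rewrite /Y cw ?b0 ?(negbTE b0).
      by rewrite addNr normr0.
    by rewrite opprK addrAC subrr add0r ger0_norm.
  split=> //; rewrite /limn_einf -sup_NY; congr (- limn_esup _)%E.
  by apply/funext => n /=; rewrite mulNr.
Qed.
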